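(* Given a voting form $g:Z\to A$, relabel its planes such that for all $i\in I$ the sequence $(s_g(i,z,a)\mid z=0,1,\dots,\alpha_i)$ is monotone non-decreasing. Then $g$ is a DAV form if and only if, after this relabeling, for all $(z_1,\dots,z_n)\in Z$: $g(z_1,\dots,z_n)=a$ if $\sum_{i\in I}z_i>\sigma/2$; $g(z_1,\dots,z_n)\in\{a,b\}$ (either value) if $\sum_{i\in I}z_i=\sigma/2$; and $g(z_1,\dots,z_n)=b$ if $\sum_{i\in I}z_i<\sigma/2$. Computing $s_g(i,z,a)$ for all $i\in I$, $z\in\mathbb{Z}_{\alpha_i}$, relabeling the planes, and checking for all $(z_1,\dots,z_n)\in Z$ whether $g(z_1,\dots,z_n)=a$ if $\sum_{i\in I}z_i>\sigma/2$, $g(z_1,\dots,z_n)\in\{a,b\}$ if $\sum_{i\in I}z_i=\sigma/2$, and $g(z_1,\dots,z_n)=b$ if $\sum_{i\in I}z_i<\sigma/2$, can be done in $O\left(\prod_{i\in I}(\alpha_i+1)\right)$ time.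
   Context: There are two candidates, $A=\{a,b\}$, and $n\ge 2$ voters $I=\{1,\dots,n\}$; voter $i$ has $\alpha_i\ge 1$ voting cards. Put $\mathbb{Z}_{\alpha_i}=\{0,1,\dots,\alpha_i\}$, $Z=\mathbb{Z}_{\alpha_1}\times\cdots\times\mathbb{Z}_{\alpha_n}$ and $\sigma=\sum_{i\in I}\alpha_i$. The integer $z_i\in\mathbb{Z}_{\alpha_i}$ denotes the strategy of voter $i$ giving $z_i$ cards to $a$ and $\alpha_i-z_i$ cards to $b$. For a vector $v\in\mathbb{Z}^A$, $AM(v)$ is the set of candidates with the maximum coordinate. A voting form is a map (an $n$-dimensional array) $g:Z\to A$. It is a distributed approval voting (DAV) form if there are permutations $\pi_i$ of $\mathbb{Z}_{\alpha_i}$, $i\in I$ (labelings of the index values by strategies), such that $g(z_1,\dots,z_n)\in AM\left(\sum_{i\in I}(\pi_i(z_i),\alpha_i-\pi_i(z_i))\right)$ for all $(z_1,\dots,z_n)\in Z$. The plane $g_{i,z}$ is the $(n-1)$-dimensional subarray of $g$ obtained by fixing the $i$th coordinate at $z$ and varying all other coordinates; relabeling the planes means permuting, for each $i\in I$, the values of the $i$th coordinate. For $i\in I$, $z\in\mathbb{Z}_{\alpha_i}$, $c\in A$: $s_g(i,z,c)=|\{(z_1,\dots,z_n)\in Z : z_i=z,\ c=g(z_1,\dots,z_n)\}|$. *)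

(* Defs.v *)
From HB Require Import structures.
From mathcomp Require Import all_boot all_order all_fingroup all_algebra.

Set Implicit Arguments.
Unset Strict Implicit.
Unset Printing Implicit Defensive.

Import Order.TTheory GRing.Theory Num.Theory.

Definition cand : finType := bool.
Definition cand_a : cand := true.
Definition cand_b : cand := false.

Definition AM (A : finType) (v : {ffun A -> int}) : {set A} :=
  [set c | [forall d, (v d <= v c)%R]].

Section VotingForms.

Variables (n : nat) (alpha : 'I_n -> nat).

Definition strat (i : 'I_n) := 'I_(alpha i).+1.

Definition profile := {dffun forall i : 'I_n, strat i}.

Definition voting_form := profile -> cand.

Definition relabeling := forall i : 'I_n, {perm strat i}.

Definition sigma : nat := \sum_i alpha i.

Definition ballot (i : 'I_n) (z : strat i) : {ffun cand -> int} :=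
  [ffun c => if c == cand_a then (z%:Z)%R else ((alpha i)%:Z - z%:Z)%R].

Definition DAV (g : voting_form) : Prop :=
  exists pi : relabeling,
    forall z : profile, g z \in AM (\sum_i ballot (pi i (z i)))%R.

Definition s (g : voting_form) (i : 'I_n) (z : strat i) (c : cand) : nat :=
  #|[set x : profile | (x i == z) && (c == g x)]|.

(* The plane of [relabel tau g] with index z in direction i is the plane of g
   with index [tau i z]. *)
Definition relabel (tau : relabeling) (g : voting_form) : voting_form :=
  fun z => g [ffun i => tau i (z i)].

Definition planes_sorted (g : voting_form) : Prop :=
  forall (i : 'I_n) (y z : strat i), y <= z -> s g y cand_a <= s g z cand_a.

Definition threshold (g : voting_form) : bool :=
  let half : rat := (sigma%:R / 2%:R)%R in
  [forall z : profile,
    let total : rat := ((\sum_i z i)%N%:R)%R in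
    [&& (half < total)%R ==> (g z == cand_a),
        (total == half) ==> (g z \in [set cand_a; cand_b])
      & (total < half)%R ==> (g z == cand_b)]].

End VotingForms.

(* Programs of a random access machine with registers, an addressable memory
   and structured control.  A program is a fixed finite piece of syntax, so it
   can neither depend on the input nor contain uncharged computations. *)

Inductive binop := Add | Sub | Mul | Leq.

Inductive expr :=
  | Const of nat
  | Reg of nat
  | Read of expr
  | Bin of binop & expr & expr.

Inductive cmd :=
  | Skip
  | Assign of nat & expr
  | Store of expr & expr
  | Seq of cmd & cmd
  | If of expr & cmd & cmd
  | While of expr & cmd.

Record state := State { reg : nat -> nat; mem : nat -> nat }.

Definition binop_sem (o : binop) (x y : nat) : nat :=
  match o with
  | Add => x + y
  | Sub => x - y
  | Mul => x * y
  | Leq => x <= y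
  end.

Fixpoint eval (e : expr) (st : state) : nat :=
  match e with
  | Const k => k
  | Reg x => reg st x
  | Read e1 => mem st (eval e1 st)
  | Bin o e1 e2 => binop_sem o (eval e1 st) (eval e2 st)
  end.

(* Every constant, register access, memory access and operation costs 1. *)
Fixpoint expr_cost (e : expr) : nat :=
  match e with
  | Const _ | Reg _ => 1
  | Read e1 => (expr_cost e1).+1
  | Bin _ e1 e2 => (expr_cost e1 + expr_cost e2).+1
  end.

Definition update (f : nat -> nat) (x v : nat) : nat -> nat :=
  fun y => if y == x then v else f y.

(* [exec W c st t st']: started in st, c halts after t steps in st', and all
   values and addresses it writes are at most W.  The bound W is the capacity
   of a machine word; it prevents unit-cost arithmetic on huge numbers.
   (Intermediate values inside an expression are then polynomial in W.)
   The test of [If] and [While] succeeds when its value is nonzero. *)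
Inductive exec (W : nat) : cmd -> state -> nat -> state -> Prop :=
  | ExecSkip st : exec W Skip st 1 st
  | ExecAssign x e st of eval e st <= W :
      exec W (Assign x e) st (expr_cost e).+1
        (State (update (reg st) x (eval e st)) (mem st))
  | ExecStore e1 e2 st of eval e1 st <= W & eval e2 st <= W :
      exec W (Store e1 e2) st (expr_cost e1 + expr_cost e2).+1
        (State (reg st) (update (mem st) (eval e1 st) (eval e2 st)))
  | ExecSeq c1 c2 st1 st2 st3 t1 t2
      of exec W c1 st1 t1 st2 & exec W c2 st2 t2 st3 :
      exec W (Seq c1 c2) st1 (t1 + t2).+1 st3
  | ExecIfT e c1 c2 st st' t of eval e st != 0 & exec W c1 st t st' :
      exec W (If e c1 c2) st (expr_cost e + t).+1 st'
  | ExecIfF e c1 c2 st st' t of eval e st = 0 & exec W c2 st t st' :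
      exec W (If e c1 c2) st (expr_cost e + t).+1 st'
  | ExecWhileT e c st1 st2 st3 t1 t2
      of eval e st1 != 0 & exec W c st1 t1 st2 & exec W (While e c) st2 t2 st3 :
      exec W (While e c) st1 (expr_cost e + t1 + t2).+1 st3
  | ExecWhileF e c st of eval e st = 0 :
      exec W (While e c) st (expr_cost e).+1 st.

Section Encoding.

Variables (n : nat) (alpha : 'I_n -> nat).

Definition table_size : nat := \prod_i (alpha i).+1.

Definition stride (i : 'I_n) : nat := \prod_(j < n | i < j) (alpha j).+1.

(* The r-th profile in lexicographic (row-major) order, for r < table_size:
   [inZp] reduces modulo (alpha i).+1. *)
Definition profile_at (r : nat) : profile alpha :=
  [ffun i : 'I_n => (inZp (r %/ stride i) : strat alpha i)].

Definition array_of (g : voting_form alpha) : seq nat :=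
  mkseq (fun r => nat_of_bool (g (profile_at r) == cand_a)) table_size.

Definition per_plane (f : forall i : 'I_n, strat alpha i -> nat) : seq nat :=
  flatten [seq [seq f i z | z <- enum 'I_(alpha i).+1] | i <- enum 'I_n].

Definition input (g : voting_form alpha) : seq nat :=
  n :: [seq alpha i | i <- enum 'I_n] ++ array_of g.

Definition initial_state (g : voting_form alpha) : state :=
  State (fun=> 0) (nth 0 (input g)).

Definition stored_at (m : nat -> nat) (p : nat) (l : seq nat) : Prop :=
  mkseq (fun j => m (p + j)) (size l) = l.

(* On halting, register 0 holds the result of the check, and registers 1, 2
   and 3 point to the numbers s_g(i, z, a), to the relabeling and to the
   relabeled array. *)
Definition output_ok (g : voting_form alpha) (st : state) : Prop :=
  stored_at (mem st) (reg st 1) (per_plane (fun i z => s g z cand_a)) /\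
  exists tau : relabeling alpha,
    [/\ planes_sorted (relabel tau g),
        stored_at (mem st) (reg st 2) (per_plane (fun i z => tau i z)),
        stored_at (mem st) (reg st 3) (array_of (relabel tau g))
      & reg st 0 = threshold (relabel tau g)].

End Encoding.

(* Main.v *)
(**
If g is a DAV form, relabeling it by its permutations gives a form h whose
entry is a when the coordinate sum exceeds sigma/2 and b when it is below, so h
is monotone in every coordinate.  By monotonicity, two parallel planes of h
with equally many entries a coincide; hence every relabeling of g that sorts
the counts produces the same array h.

For the running time, let N be the size of the array.  Summing out the
coordinates one after the other, last one first, visits arrays whose sizes at
least halve at each step, hence O(N) entries in total, and produces all the
counts.  There are at most N pairs (i, z) and all the counts are at most N, so a
single bucket sort of all the pairs sorts the planes in all directions at once
(one bucket sort per direction could cost about n N).  The relabeled position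
and the coordinate sum of every profile are computed by extending prefixes of
profiles by one coordinate, over arrays whose sizes at least double.
*)

Require Import Defs.
From mathcomp Require Import all_boot all_order all_fingroup all_algebra.
From mathcomp Require Import zify.

Set Implicit Arguments.
Unset Strict Implicit.
Unset Printing Implicit Defensive.

Import Order.TTheory GRing.Theory Num.Theory.

(** * The characterization *)

Section Characterization.

Variables (n : nat) (alpha : 'I_n -> nat).
Implicit Types (g h : voting_form alpha) (x z : profile alpha).

(** Both sides of the equivalence are reduced to [admissible], which compares twice a coordinate sum
    with sigma in [nat] and accepts either candidate at a tie. Distinct strategies may have equal
    counts, so a sorting relabeling is not unique; no canonical one is chosen, and the given
    relabeling is compared with the one coming from the DAV permutations.

    On the machine side, everything rests on the factors alpha i + 1 being at least 2: this makes
    prefix products double, so that all prefix arrays together have fewer than 2N entries, and it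
    bounds the sum M of the factors by N. Memory regions start at multiples of N, so that their
    disjointness is linear arithmetic. All written addresses and values stay below 23N; the proof
    works with a word capacity of at least 64N, and 64N <= N^4 because N >= 4. *)

Definition admissible (c : cand) (t : nat) : bool :=
  if c then sigma alpha <= t.*2 else t.*2 <= sigma alpha.

Lemma ballot_sum (y : forall i : 'I_n, strat alpha i) (c : cand) :
  ((\sum_i ballot (y i)) c =
   if c then (\sum_i y i)%N%:Z else (sigma alpha)%:Z - (\sum_i y i)%N%:Z)%R.
Proof.
rewrite sum_ffunE; case: c; rewrite /sigma /=.
  rewrite (big_morph Posz (id1 := 0%R) (op1 := +%R)) //.
  by apply: eq_bigr => i _; rewrite ffunE.
rewrite !(big_morph Posz (id1 := 0%R) (op1 := +%R)) // -GRing.sumrB.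
by apply: eq_bigr => i _; rewrite ffunE.
Qed.

Lemma mem_AM_ballots (y : forall i : 'I_n, strat alpha i) (c : cand) :
  (c \in AM (\sum_i ballot (y i))%R) = admissible c (\sum_i y i).
Proof.
rewrite inE /admissible; apply/forallP/idP => [/(_ (~~ c)) | H d].
  by rewrite !ballot_sum; case: c => /=; lia.
rewrite !ballot_sum; case: c d H => -[] //=; lia.
Qed.

Lemma DAVE g :
  DAV g <-> exists pi : relabeling alpha,
    forall z, admissible (g z) (\sum_i pi i (z i)).
Proof.
by split=> -[pi H]; exists pi => z; move: (H z);
  rewrite (mem_AM_ballots (fun i => pi i (z i))).
Qed.

Lemma eq_cand_a (c : cand) : (c == cand_a) = c. Proof. by case: c. Qed.
Lemma eq_cand_b (c : cand) : (c == cand_b) = ~~ c. Proof. by case: c. Qed.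

Lemma thresholdP h :
  reflect (forall z, admissible (h z) (\sum_i z i)) (threshold h).
Proof.
apply: (iffP forallP) => H z; move: (H z); rewrite /admissible eq_cand_a eq_cand_b;
  set t := (\sum_i z i)%N; set u := sigma alpha.
  case/and3P; rewrite ltr_pdivrMr // ltr_pdivlMr // -natrM !ltr_nat.
  by case: (h z) => /= ? ? ?; lia.
rewrite ltr_pdivrMr // ltr_pdivlMr // -natrM !ltr_nat => {}H.
apply/and3P; split; first by apply/implyP; case: (h z) H => //=; lia.
  by apply/implyP => _; rewrite !inE; case: (h z).
by apply/implyP; case: (h z) H => //=; lia.
Qed.

(** * Monotone forms and their parallel planes *)

Definition set_coord x (i : 'I_n) (u : strat alpha i) : profile alpha :=
  [ffun j => dfwith (fun j => x j) u j].

Lemma set_coord_id x i (u : strat alpha i) : set_coord x u i = u.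
Proof. by rewrite ffunE dfwith_in. Qed.

Lemma set_coord_neq x i (u : strat alpha i) j : i != j -> set_coord x u j = x j.
Proof. by move=> ne; rewrite ffunE dfwith_out. Qed.

Lemma sum_set_coord x i (u : strat alpha i) :
  (\sum_j set_coord x u j + x i = \sum_j x j + u)%N.
Proof.
rewrite (bigD1 i) //= [in RHS](bigD1 i) //= set_coord_id.
under eq_bigr => j ne do rewrite set_coord_neq 1?eq_sym //.
lia.
Qed.

(** An entry a at [u] forces twice the sum to reach sigma. The sum at [v] is strictly larger, hence
    beyond any tie, and excludes b. *)
Lemma admissible_mono h x i (u v : strat alpha i) :
  (forall z, admissible (h z) (\sum_i z i)) -> u < v ->
  h (set_coord x u) -> h (set_coord x v).
Proof.
move=> H uv; move: (H (set_coord x u)) (H (set_coord x v)).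
have := sum_set_coord x u; have := sum_set_coord x v.
by rewrite /admissible; do 2 case: (h _) => //; lia.
Qed.

Lemma card_plane h i (z : strat alpha i) :
  s h z cand_a = #|[set x : profile alpha | (x i == z) && h x]|.
Proof. by apply: eq_card => x; rewrite !inE; case: (h x). Qed.

Lemma set_coordK x i (u w : strat alpha i) :
  x i = w -> set_coord (set_coord x u) w = x.
Proof.
move=> <-; apply/ffunP => j; case: (eqVneq i j) => [<-|ne].
  by rewrite set_coord_id.
by rewrite !set_coord_neq.
Qed.

Lemma set_coord_same x i (w : strat alpha i) : x i = w -> set_coord x w = x.
Proof.
move=> <-; apply/ffunP => j; case: (eqVneq i j) => [<-|ne].
  by rewrite set_coord_id.
by rewrite set_coord_neq.
Qed.

(** Moving coordinate [i] from [y] to [z] injects the entries a of one plane into those of the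
    other. Equal cardinalities make the injection onto, so each entry a of the plane [z] comes from
    one at the same place of the plane [y]. *)
Lemma plane_leqif h i (y z : strat alpha i) :
  (forall x, h (set_coord x y) -> h (set_coord x z)) ->
  s h y cand_a <= s h z cand_a ?= iff
     [forall x, h (set_coord x z) ==> h (set_coord x y)].
Proof.
move=> mono; rewrite !card_plane.
set Y := [set x : profile alpha | (x i == y) && h x].
set Z := [set x : profile alpha | (x i == z) && h x].
have injY : {in Y &, injective (fun x => set_coord x z)}.
  move=> x x'; rewrite !inE => /andP[/eqP xy _] /andP[/eqP xy' _] E.
  by rewrite -(set_coordK z xy) E set_coordK.
have sub : [set set_coord x z | x in Y] \subset Z.
  apply/subsetP => _ /imsetP[x + ->]; rewrite !inE set_coord_id eqxx.
  by case/andP => /eqP xy hx; apply: mono; rewrite set_coord_same.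
have := subset_leqif_cards sub; rewrite card_in_imset // => -[le eq].
split=> //; rewrite eq.
apply/eqP/forallP => [E x | H].
  apply/implyP => hz; have : set_coord x z \in Z by rewrite inE set_coord_id eqxx.
  rewrite -E => /imsetP[x']; rewrite inE => /andP[/eqP xy hx'] E'.
  suff -> : set_coord x y = x' by [].
  apply/ffunP => j; case: (eqVneq i j) => [<-|ne]; first by rewrite set_coord_id.
  by rewrite set_coord_neq // -(set_coord_neq x z ne) E' set_coord_neq.
apply/eqP; rewrite eqEsubset sub; apply/subsetP => x.
rewrite inE => /andP[/eqP xz hx]; apply/imsetP; exists (set_coord x y).
  by rewrite inE set_coord_id eqxx /=; apply: (implyP (H x)); rewrite set_coord_same.
by rewrite set_coordK.
Qed.

Lemma admissible_sorted h :
  (forall z, admissible (h z) (\sum_i z i)) -> planes_sorted h.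
Proof.
move=> H i y z; rewrite leq_eqVlt => /orP[/eqP/val_inj -> //|yz].
by have [] := plane_leqif (fun x => admissible_mono H (x := x) yz).
Qed.

Lemma admissible_plane_eq h x i (y z : strat alpha i) :
  (forall z, admissible (h z) (\sum_i z i)) ->
  s h y cand_a = s h z cand_a -> h (set_coord x y) = h (set_coord x z).
Proof.
move=> H; wlog yz : y z / y < z.
  move=> W E; case: (ltngtP y z) => [yz|zy|/val_inj -> //]; first exact: W.
  by symmetry; apply: W.
move=> E; have mono x' := admissible_mono H (x := x') yz.
have [_ /esym] := plane_leqif mono; rewrite E eqxx => /forallP/(_ x).
by move: (mono x); do 2 case: (h _) => //=; move=> /(_ isT).
Qed.

(** The values of [f] and of [f \o r], listed in order, are two sorted rearrangements of one
    multiset. *)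
Lemma sorted_perm_eq m (f : 'I_m -> nat) (r : {perm 'I_m}) :
  {homo f : y z / y <= z} -> {homo f \o r : y z / y <= z} -> f \o r =1 f.
Proof.
move=> sf sfr.
have so (f' : 'I_m -> nat) : {homo f' : y z / y <= z} ->
    sorted leq [seq f' i | i <- enum 'I_m].
  move=> h; rewrite sorted_map; have := iota_sorted 0 m.
  rewrite -val_enum_ord sorted_map; apply: sub_sorted => y z /=; exact: h.
have E : [seq (f \o r) i | i <- enum 'I_m] = [seq f i | i <- enum 'I_m].
  apply: (sorted_eq leq_trans anti_leq); try exact: so.
  rewrite (map_comp f r); apply: perm_map; rewrite uniq_perm ?enum_uniq //.
    by rewrite map_inj_uniq ?enum_uniq //; exact: perm_inj.
  move=> j; rewrite mem_enum; apply/mapP; exists ((r^-1)%g j).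
    by rewrite mem_enum.
  by rewrite permKV.
by move=> i; have /eq_in_map/(_ i) := E; apply; rewrite mem_enum.
Qed.

Lemma relabel_comp (t1 t2 : relabeling alpha) g :
  relabel t1 (relabel t2 g) =1 relabel (fun i => (t1 i * t2 i)%g) g.
Proof. by move=> x; congr (g _); apply/ffunP => i; rewrite !ffunE permM. Qed.

Lemma s_relabel (t : relabeling alpha) g i (z : strat alpha i) c :
  s (relabel t g) z c = s g (t i z) c.
Proof.
pose f x : profile alpha := [ffun i => t i (x i)].
rewrite /s -(card_imset _ (f := f)) {}/f; last first.
  by move=> x y /ffunP E; apply/ffunP => j; move: (E j); rewrite !ffunE => /perm_inj.
apply: eq_card => x; rewrite !inE; apply/imsetP/idP => [[y] | /andP[/eqP xi e]].
  by rewrite inE => /andP[/eqP <- e] ->; rewrite ffunE eqxx.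
exists [ffun i => ((t i)^-1)%g (x i)].
  rewrite inE ffunE xi permK eqxx (eqP e) /=; apply/eqP; congr (g _).
  by apply/ffunP => j; rewrite !ffunE permKV.
by apply/ffunP => j; rewrite !ffunE permKV.
Qed.

Lemma eq_admissible_relabel h (r : relabeling alpha) :
  (forall z, admissible (h z) (\sum_i z i)) ->
  (forall i (z : strat alpha i), s h (r i z) cand_a = s h z cand_a) -> relabel r h =1 h.
Proof.
move=> H E x.
(* Hybrid argument: [r] acts only on the coordinates below [k]. Passing to [k.+1] changes one
   coordinate, between two planes with equal counts, which coincide. *)
have K k : h [ffun i : 'I_n => if i < k then r i (x i) else x i] = h x.
  elim: k => [|k IH]; first by congr h; apply/ffunP => i; rewrite ffunE.
  case: (ltnP k n) => kn; last first.
    rewrite -{}IH; congr h; apply/ffunP => i; rewrite !ffunE.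
    by rewrite !(leq_trans (ltn_ord i)) // ltnW.
  set i := Ordinal kn; set y := [ffun i : 'I_n => if i < k then _ else _] in IH.
  rewrite -{}IH -[y in RHS](set_coordK (r i (x i)) (erefl (y i))).
  have -> : set_coord (set_coord y (r i (x i))) (y i) = set_coord y (y i).
    apply/ffunP => j; case: (eqVneq i j) => [<-|ne]; first by rewrite !set_coord_id.
    by rewrite !set_coord_neq.
  have -> : h (set_coord y (y i)) = h (set_coord y (r i (x i))).
    by apply: admissible_plane_eq => //; rewrite E ffunE /= ltnn.
  congr h; apply/ffunP => j; case: (eqVneq i j) => [<-|ne].
    by rewrite set_coord_id ffunE /= ltnSn.
  rewrite set_coord_neq // !ffunE ltnS leq_eqVlt; case: eqVneq => // jk.
  by case/eqP: ne; apply: val_inj.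
rewrite -(K n); congr h; apply/ffunP => i; by rewrite !ffunE ltn_ord.
Qed.

Lemma characterization g (t : relabeling alpha) :
  planes_sorted (relabel t g) -> DAV g <-> threshold (relabel t g).
Proof.
move=> so; rewrite DAVE; split=> [[p H]|/thresholdP H]; last first.
  (* Inverses, because [relabel] reads the plane [t i z], whereas a DAV labeling is applied to the
     original index. *)
  exists (fun i => (t i)^-1)%g => z.
  have := H [ffun i => ((t i)^-1)%g (z i)]; rewrite /relabel.
  have -> : [ffun i => t i ([ffun i => ((t i)^-1)%g (z i)] i)] = z.
    by apply/ffunP => i; rewrite !ffunE permKV.
  by under eq_bigr => i _ do rewrite ffunE.
pose h := relabel (fun i => (p i)^-1)%g g.
have Hh : forall z, admissible (h z) (\sum_i z i).
  move=> z; have := H [ffun i => ((p i)^-1)%g (z i)]; rewrite /h /relabel.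
  by under eq_bigr => i _ do rewrite ffunE permKV.
(* The product applies [t] first. [r] leads from the DAV labeling to the given sorting, and [h] has
   sorted counts both before and after it. *)
pose r i : {perm strat alpha i} := (t i * p i)%g.
have gE : relabel t g =1 relabel r h.
  move=> x; rewrite /h relabel_comp; congr g; apply/ffunP => i.
  by rewrite !ffunE /r mulgK.
have sE i (z : strat alpha i) : s (relabel t g) z cand_a = s (relabel r h) z cand_a.
  by apply: eq_card => x; rewrite !inE gE.
have Er i (z : strat alpha i) : s h (r i z) cand_a = s h z cand_a.
  have sr : {homo (fun u : strat alpha i => s h u cand_a) \o r i : y z / y <= z}.
    by move=> y y' yy' /=; rewrite -!s_relabel -!sE; apply: so.
  exact: (sorted_perm_eq (admissible_sorted Hh (i := i)) sr z).
apply/thresholdP => z; rewrite gE eq_admissible_relabel //.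
Qed.

End Characterization.

(** * A program logic with running time *)

Definition wp (W : nat) (c : cmd) (t : nat) (st : state) (Q : state -> Prop) :=
  exists t' st', [/\ exec W c st t' st', t' <= t & Q st'].

Section Wp.
Variable W : nat.
Implicit Types (c : cmd) (e : expr) (st : state) (r m : nat -> nat)
  (Q : state -> Prop).

Lemma wp_weaken c t t' st Q Q' :
  wp W c t st Q -> t <= t' -> (forall st', Q st' -> Q' st') -> wp W c t' st Q'.
Proof.
move=> [u [st' [ex le q]]] tt' imp; exists u, st'.
by split; [|apply: leq_trans tt'|apply: imp].
Qed.

Lemma wp_le c t t' st Q : wp W c t st Q -> t <= t' -> wp W c t' st Q.
Proof. by move=> H le; apply: wp_weaken H le _. Qed.

Lemma wp_seq c1 c2 t1 t2 st Q :
  wp W c1 t1 st (fun st' => wp W c2 t2 st' Q) ->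
  wp W (Seq c1 c2) (t1 + t2).+1 st Q.
Proof.
move=> [u1 [st1 [ex1 le1 [u2 [st2 [ex2 le2 q]]]]]]; exists (u1 + u2).+1, st2.
by split=> //; [apply: ExecSeq ex1 ex2 | rewrite ltnS leq_add].
Qed.

Lemma wp_skip st Q : Q st -> wp W Skip 1 st Q.
Proof. by move=> q; exists 1, st; split=> //; apply: ExecSkip. Qed.

(** Stated with a continuation [c], so that applying it runs a program forward one command at a
    time; this is why blocks of the program end in [Skip]. The value [v] is supplied as a
    mathematical expression, which keeps the state readable. *)
Lemma wp_assign x e v c t r m Q :
  eval e (State r m) = v -> v <= W ->
  wp W c t (State (update r x v) m) Q ->
  wp W (Seq (Assign x e) c) ((expr_cost e).+1 + t).+1 (State r m) Q.
Proof.
move=> ev vW H; apply: wp_seq; exists (expr_cost e).+1, (State (update r x v) m).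
by split=> //; rewrite -ev; apply: (@ExecAssign W x e (State r m)); rewrite ev.
Qed.

Lemma wp_store e1 e2 a v c t r m Q :
  eval e1 (State r m) = a -> eval e2 (State r m) = v -> a <= W -> v <= W ->
  wp W c t (State r (update m a v)) Q ->
  wp W (Seq (Store e1 e2) c) ((expr_cost e1 + expr_cost e2).+1 + t).+1
    (State r m) Q.
Proof.
move=> ea ev aW vW H; apply: wp_seq.
exists (expr_cost e1 + expr_cost e2).+1, (State r (update m a v)).
by split=> //; rewrite -ea -ev; apply: (@ExecStore W e1 e2 (State r m)); rewrite ?ea ?ev.
Qed.

(** [K] is the exact number of rounds and [T k] bounds the cost of round [k]; non-uniform costs
    allow geometric and amortized bounds. The test is paid in every round and once more at the
    exit. *)
Lemma wp_while (K : nat) (T : nat -> nat) (Inv : nat -> state -> Prop) e c st Q :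
  (forall k st', k < K -> Inv k st' ->
     eval e st' != 0 /\ wp W c (T k) st' (Inv k.+1)) ->
  (forall st', Inv K st' -> eval e st' = 0 /\ Q st') ->
  Inv 0 st ->
  wp W (While e c) (\sum_(k < K) (T k + (expr_cost e).+1) + (expr_cost e).+1) st Q.
Proof.
elim: K T Inv st => [|K IH] T Inv st step fin inv.
  have [e0 q] := fin _ inv; exists (expr_cost e).+1, st.
  by split=> //; [apply: ExecWhileF | rewrite leq_addl].
have [//|e1 [u [st1 [ex le inv1]]]] := step 0 st _ inv.
have [k st' kK|u' [st' [ex' le' q]]] :=
  IH (fun k => T k.+1) (fun k => Inv k.+1) st1 _ fin inv1.
  exact: step.
exists (expr_cost e + u + u').+1, st'; split=> //; first exact: ExecWhileT ex ex'.
have -> : \sum_(k < K.+1) (T k + (expr_cost e).+1) =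
    T 0 + (expr_cost e).+1 + \sum_(k < K) (T k.+1 + (expr_cost e).+1).
  exact: big_ord_recl.
lia.
Qed.

Lemma wp_for (K T : nat) (Inv : nat -> state -> Prop) e c st Q :
  (forall k st', k < K -> Inv k st' ->
     eval e st' != 0 /\ wp W c T st' (Inv k.+1)) ->
  (forall st', Inv K st' -> eval e st' = 0 /\ Q st') ->
  Inv 0 st ->
  wp W (While e c) (K * (T + (expr_cost e).+1) + (expr_cost e).+1) st Q.
Proof.
move=> H1 H2 H3; have := wp_while H1 H2 H3.
by rewrite sum_nat_const card_ord.
Qed.

End Wp.

Lemma upd_same f x v : update f x v x = v.
Proof. by rewrite /update eqxx. Qed.

Lemma upd_other f x v y : (y == x) = false -> update f x v y = f y.
Proof. by rewrite /update => ->. Qed.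

Ltac upd :=
  repeat match goal with
  | |- context [update ?f ?x ?v ?y] =>
    first [ rewrite (@upd_same f y v)
          | rewrite (@upd_other f x v y); [ | first [ reflexivity | apply/eqP; lia ]]]
  end.

Ltac ev := rewrite /=; upd.

Declare Scope prog_scope.
Delimit Scope prog_scope with prog.
Bind Scope prog_scope with expr.
Bind Scope prog_scope with cmd.
Notation "'$' x" := (Reg x) (at level 5, x at level 4, format "'$' x") : prog_scope.
Notation "@[ e ]" := (Read e) (at level 0, e at level 99) : prog_scope.
Notation "a + b" := (Bin Add a b) : prog_scope.
Notation "a - b" := (Bin Defs.Sub a b) : prog_scope.
Notation "a * b" := (Bin Mul a b) : prog_scope.
Notation "a <= b" := (Bin Leq a b) : prog_scope.
Notation "a < b" := (Bin Leq (Bin Add a (Const 1)) b) : prog_scope.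
Notation "x ::= e" := (Assign x e) (at level 75) : prog_scope.
Notation "e1 :<- e2" := (Store e1 e2) (at level 75) : prog_scope.
Notation "c1 ;; c2" := (Seq c1 c2) (at level 80, right associativity) : prog_scope.
Coercion Const : nat >-> expr.

Definition keeps (xs : seq nat) (f f' : nat -> nat) :=
  forall x, x \notin xs -> f' x = f x.

Lemma keeps_upd xs f f' x v :
  x \in xs -> keeps xs f f' -> keeps xs f (update f' x v).
Proof.
move=> xin H y ynotin; rewrite upd_other ?H //.
by apply: contraNF ynotin => /eqP ->.
Qed.

Lemma keeps_trans xs f f' f'' : keeps xs f f' -> keeps xs f' f'' -> keeps xs f f''.
Proof. by move=> H H' x xs'; rewrite H' ?H. Qed.

Lemma keeps_sub xs ys f f' : {subset xs <= ys} -> keeps xs f f' -> keeps ys f f'.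
Proof. by move=> sub H x xs'; rewrite H //; apply: contraNN xs' => /sub. Qed.

(** * The program *)

(* With [ms i = alpha i + 1], [N] the product and [M] the sum of the [ms i], and
   the pair (i, z) numbered [off i + z], [off i] being the sum of the [ms j] for
   [j < i]:
   - registers: 4 = N, 5 = running number of a pair (M after [sizes_prog] and
     after [expand_prog]), 6 = coordinate i (or bucket v), 7, 8, 9 = current
     array entry, end of the current array, next free cell, 10 = z, 12 = ms i;
   - memory: the input and, right after it, the successive collapsed arrays
     (below 3N), the counts s(i, z) (from 4N), the heads of the buckets (6N),
     their links (8N), the components i (10N) and z (12N) of each pair, the
     first free place in the sorted list of each direction (14N), the sorted
     lists, which are the relabeling (16N), the relabeled positions (18N) and
     the coordinate sums (20N) of the prefixes of profiles, and the relabeled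
     array (22N).
   Links store p + 1 for the pair p, and 0 marks the end of a bucket. *)
Definition dim_size (i : expr) : expr := @[i + 1] + 1.
Definition base (k : nat) : expr := k * $4.

Definition sizes_prog : cmd :=
  4 ::= 1 ;; 5 ::= 0 ;; 6 ::= 0 ;;
  While ($6 < @[0])
    (4 ::= $4 * dim_size $6 ;;
     5 ::= $5 + dim_size $6 ;;
     6 ::= $6 + 1 ;; Skip) ;;
  Skip.

(** Each entry is read for two purposes: it is added to the count of its last coordinate, and to the
    row sum that becomes one entry of the next, smaller array. *)
Definition collapse_row : cmd :=
  While ($10 < $12)
    (base 4 + $5 + $10 :<- @[base 4 + $5 + $10] + @[$7] ;;
     11 ::= $11 + @[$7] ;; 7 ::= $7 + 1 ;; 10 ::= $10 + 1 ;; Skip).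

Definition collapse_level : cmd :=
  While ($7 < $8)
    (11 ::= 0 ;; 10 ::= 0 ;; collapse_row ;;
     $9 :<- $11 ;; 9 ::= $9 + 1 ;; Skip).

Definition collapse_prog : cmd :=
  7 ::= @[0] + 1 ;; 9 ::= $7 + $4 ;;
  While (1 <= $6)
    (6 ::= $6 - 1 ;; 12 ::= dim_size $6 ;; 5 ::= $5 - $12 ;; 8 ::= $9 ;;
     collapse_level ;; Skip) ;;
  Skip.

Definition insert_level : cmd :=
  While ($10 < $12)
    (11 ::= base 6 + @[base 4 + $5] ;;
     base 8 + $5 :<- @[$11] ;; $11 :<- $5 + 1 ;;
     base 10 + $5 :<- $6 ;; base 12 + $5 :<- $10 ;;
     5 ::= $5 + 1 ;; 10 ::= $10 + 1 ;; Skip).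

Definition insert_prog : cmd :=
  While ($6 < @[0])
    (12 ::= dim_size $6 ;; base 14 + $6 :<- $5 ;; 10 ::= 0 ;;
     insert_level ;; 6 ::= $6 + 1 ;; Skip).

(** The buckets come by increasing count, and each pair goes to the next free place of its own
    direction; appending in this order leaves every list sorted. *)
Definition place_bucket : cmd :=
  While $11
    (10 ::= $11 - 1 ;; 12 ::= @[base 10 + $10] ;; 13 ::= @[base 14 + $12] ;;
     base 16 + $13 :<- @[base 12 + $10] ;; base 14 + $12 :<- $13 + 1 ;;
     11 ::= @[base 8 + $10] ;; Skip).

Definition place_prog : cmd :=
  6 ::= 0 ;;
  While ($6 <= $4)
    (11 ::= @[base 6 + $6] ;; place_bucket ;; 6 ::= $6 + 1 ;; Skip).

Definition expand_row : cmd :=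
  While ($10 < $12)
    (base 18 + $9 :<- @[base 18 + $7] * $12 + @[base 16 + $5 + $10] ;;
     base 20 + $9 :<- @[base 20 + $7] + $10 ;;
     9 ::= $9 + 1 ;; 10 ::= $10 + 1 ;; Skip).

Definition expand_level : cmd :=
  While ($7 < $8) (10 ::= 0 ;; expand_row ;; 7 ::= $7 + 1 ;; Skip).

Definition expand_prog : cmd :=
  5 ::= 0 ;; 6 ::= 0 ;; 7 ::= 0 ;; 9 ::= 1 ;; base 18 :<- 0 ;; base 20 :<- 0 ;;
  While ($6 < @[0])
    (12 ::= dim_size $6 ;; 8 ::= $9 ;; expand_level ;;
     5 ::= $5 + $12 ;; 6 ::= $6 + 1 ;; Skip).

(** [$5 - @[0]] is M - n, which equals sigma. The entry in register 11 is 0 or 1 and selects the one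
    inequality to be tested. Register 7 points to the last level of the prefix arrays. *)
Definition check_prog : cmd :=
  0 ::= 1 ;; 6 ::= 0 ;;
  While ($6 < $4)
    (11 ::= @[@[0] + 1 + @[base 18 + $7 + $6]] ;;
     base 22 + $6 :<- $11 ;;
     10 ::= 2 * @[base 20 + $7 + $6] ;;
     0 ::= $0 * ($11 * ($5 - @[0] <= $10) + (1 - $11) * ($10 <= $5 - @[0])) ;;
     6 ::= $6 + 1 ;; Skip) ;;
  1 ::= base 4 ;; 2 ::= base 16 ;; 3 ::= base 22 ;; Skip.

Definition main_prog : cmd :=
  sizes_prog ;; collapse_prog ;; insert_prog ;; place_prog ;; expand_prog ;;
  check_prog.

(** * Mixed radix numeration *)

Lemma sum_block a b (F : nat -> nat) :
  \sum_(t < a * b) F t = \sum_(z < a) \sum_(t < b) F (z * b + t).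
Proof.
elim: a => [|a IH]; first by rewrite !big_ord0.
by rewrite big_ord_recr /= -IH mulSnr big_split_ord.
Qed.

Section MixedRadix.

Variable ms : nat -> nat.
Hypothesis ms2 : forall j, 2 <= ms j.

Definition pre k := \prod_(j < k) ms j.
Definition off k := \sum_(j < k) ms j.

Lemma preS k : pre k.+1 = pre k * ms k. Proof. exact: big_ord_recr. Qed.
Lemma offS k : off k.+1 = off k + ms k. Proof. exact: big_ord_recr. Qed.
Lemma pre0 : pre 0 = 1. Proof. exact: big_ord0. Qed.
Lemma off0 : off 0 = 0. Proof. exact: big_ord0. Qed.

Lemma pre_gt0 k : 0 < pre k.
Proof. by rewrite prodn_gt0 // => i; apply: ltnW. Qed.

Lemma pre_le j k : j <= k -> pre j <= pre k.
Proof.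
move=> jk; rewrite -(subnK jk); elim: (k - j) => // d; rewrite addSn preS.
by have := ms2 (d + j); nia.
Qed.

Lemma off_le j k : j <= k -> off j <= off k.
Proof.
move=> jk; rewrite -(subnK jk); elim: (k - j) => // d; rewrite addSn offS.
by move/leq_trans; apply; apply: leq_addr.
Qed.

(** Induction by x + y <= x y for x, y >= 2. It starts at one factor, because the step needs a
    product of at least 2. *)
Lemma off_le_pre k : 0 < k -> off k <= pre k.
Proof.
case: k => // k _; elim: k => [|k IH]; first by rewrite preS offS pre0 off0; lia.
have g2 : 2 <= pre k.+1 by rewrite preS; have := pre_gt0 k; have := ms2 k; nia.
by rewrite preS offS; have := ms2 k.+1; nia.
Qed.

Lemma double_le_off k : k.*2 <= off k.
Proof. by elim: k => // k IH; rewrite offS; have := ms2 k; lia. Qed.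

Lemma off_inj i j y z : y < ms i -> z < ms j ->
  off i + y = off j + z -> i = j /\ y = z.
Proof.
move=> yi zj E; case: (ltngtP i j) => [ij|ji|ij].
- by have := off_le ij; rewrite offS; lia.
- by have := off_le ji; rewrite offS; lia.
- by split=> //; move: E; rewrite ij => /addnI.
Qed.

Lemma off_split p k : p < off k -> exists i z, [/\ i < k, z < ms i & p = off i + z].
Proof.
elim: k => [|k IH]; first by rewrite off0.
rewrite offS; case: (ltnP p (off k)) => [/IH [i [z [ik zi ->]]] _ | kp pk].
  by exists i, z; split=> //; apply: ltnW.
by exists k, (p - off k); split=> //; lia.
Qed.

(** Start of the array of prefixes of length [k] when the arrays for lengths 0, 1, ... are laid end
    to end. *)
Definition stack k := \sum_(j < k) pre j.

Lemma stackS k : stack k.+1 = stack k + pre k. Proof. exact: big_ord_recr. Qed.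

(** The induction step is 2 [pre k] <= [pre k.+1]. The linear bounds on the passes over all prefix
    arrays come from this estimate. *)
Lemma stack_lt k : stack k < pre k.
Proof.
elim: k => [|k IH]; first by rewrite /stack big_ord0 pre0.
by rewrite stackS preS; have := ms2 k; nia.
Qed.

Lemma stack_le j k : j <= k -> stack j <= stack k.
Proof.
move=> jk; rewrite -(subnK jk); elim: (k - j) => // d; rewrite addSn stackS.
by move/leq_trans; apply; apply: leq_addr.
Qed.

Lemma sum_pre k : \sum_(j < k) pre j.+1 <= (pre k).*2.
Proof.
suff : \sum_(j < k) pre j.+1 + 1 = stack k.+1.
  by have := stack_lt k; rewrite stackS; lia.
by rewrite /stack big_ord_recl pre0 addnC.
Qed.

(** Coordinate 0 is the most significant digit, as in the row-major order of [profile_at]; adding a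
    coordinate then extends an index on the right, by Horner's rule. *)
Definition dig k q j := (q %/ \prod_(j.+1 <= l < k) ms l) %% ms j.

Fixpoint horner_index k (d : nat -> nat) :=
  if k is k'.+1 then horner_index k' d * ms k' + d k' else 0.

Lemma eq_horner_index k d d' :
  (forall j, j < k -> d j = d' j) -> horner_index k d = horner_index k d'.
Proof.
elim: k => //= k IH E; rewrite IH ?E // => j jk; apply: E; exact: ltnW.
Qed.

Lemma horner_index_lt k d : (forall j, j < k -> d j < ms j) -> horner_index k d < pre k.
Proof.
elim: k => [|k IH] dm /=; first by rewrite pre0.
have := IH (fun j jk => dm j (ltnW jk)); have := dm k (ltnSn k); rewrite preS; nia.
Qed.

Lemma dig_lt k q j : dig k q j < ms j.
Proof. by rewrite ltn_pmod // ltnW. Qed.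

Lemma dig_last k q z : z < ms k -> dig k.+1 (q * ms k + z) k = z.
Proof. by move=> zk; rewrite /dig big_geq // divn1 modnMDl modn_small. Qed.

Lemma dig_init k q z j : z < ms k -> j < k ->
  dig k.+1 (q * ms k + z) j = dig k q j.
Proof.
move=> zk jk; rewrite /dig big_nat_recr //= [X in _ %/ X]mulnC divnMA.
rewrite divnMDl ?(divn_small zk) ?addn0 //.
by apply: ltnW.
Qed.

Lemma horner_dig k q : q < pre k -> horner_index k (dig k q) = q.
Proof.
elim: k q => [|k IH] q /=; first by rewrite pre0; case: q.
have mk : 0 < ms k by apply: ltnW.
rewrite preS => qk; have zk : q %% ms k < ms k by rewrite ltn_pmod.
have E := divn_eq q (ms k); have lt : q %/ ms k < pre k by rewrite ltn_divLR.
have last_dig : dig k.+1 q k = q %% ms k by rewrite {1}E dig_last.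
rewrite last_dig [RHS]E; congr (_ * _ + _); rewrite -[RHS](IH _ lt).
by apply: eq_horner_index => j jk; rewrite {1}E dig_init.
Qed.

Lemma dig_horner k d j : (forall j, j < k -> d j < ms j) -> j < k ->
  dig k (horner_index k d) j = d j.
Proof.
elim: k => // k IH dm; rewrite ltnS leq_eqVlt => /orP[/eqP->|jk] /=.
  by rewrite dig_last ?dm.
by rewrite dig_init ?dm ?IH // => l lk; rewrite dm // ltnW.
Qed.

Definition digit_sum k q := \sum_(j < k) dig k q j.

Lemma digit_sumS k q z : z < ms k ->
  digit_sum k.+1 (q * ms k + z) = digit_sum k q + z.
Proof.
move=> zk; rewrite /digit_sum big_ord_recr /= dig_last //; congr (_ + _).
by apply: eq_bigr => j _; rewrite dig_init.
Qed.

Lemma digit_sum_le k q : digit_sum k q <= off k.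
Proof. by apply: leq_sum => j _; apply/ltnW/dig_lt. Qed.

(** Position in the original array of the entry that the relabeling puts at position [q]. *)
Definition relabeled (p : nat -> nat -> nat) k q :=
  horner_index k (fun j => p j (dig k q j)).

Lemma relabeled_lt p k q : (forall i z, i < k -> z < ms i -> p i z < ms i) ->
  relabeled p k q < pre k.
Proof.
by move=> p_lt; apply: horner_index_lt => j jk; rewrite p_lt ?dig_lt.
Qed.

Lemma relabeledS p k q z : z < ms k ->
  relabeled p k.+1 (q * ms k + z) = relabeled p k q * ms k + p k z.
Proof.
move=> zk; rewrite /relabeled /= dig_last //; congr (_ * _ + _).
by apply: eq_horner_index => j jk; rewrite dig_init.
Qed.

Variable n : nat.
Local Notation N := (pre n).
Local Notation M := (off n).

Definition suf k := \prod_(k <= j < n) ms j.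

Lemma suf_n : suf n = 1. Proof. by rewrite /suf big_geq. Qed.

Lemma sufS k : k < n -> suf k = ms k * suf k.+1.
Proof. by move=> kn; rewrite /suf big_ltn. Qed.

Lemma pre_suf k : k <= n -> pre k * suf k = N.
Proof.
by move=> kn; rewrite /pre /suf -!(big_mkord xpredT ms) -big_cat_nat.
Qed.

(** * Correctness and running time of the program *)

Variable A : nat -> nat.
Hypothesis A1 : forall q, A q <= 1.

(* [col k] is the array with the coordinates k, ..., n - 1 summed out. *)
Definition col k q := \sum_(t < suf k) A (q * suf k + t).

(** Content of the count cell of (i, z) once the first [q] rows of its level have been scanned. *)
Definition key_upto i q z := \sum_(x < q) col i.+1 (x * ms i + z).
Definition key i z := key_upto i (pre i) z.

Lemma colS k q : k < n -> col k q = \sum_(z < ms k) col k.+1 (q * ms k + z).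
Proof.
move=> kn; rewrite /col sufS // (sum_block _ _ (fun t => A (_ + t))).
apply: eq_bigr => z _; apply: eq_bigr => t _; congr A; lia.
Qed.

Lemma col_le k q : col k q <= suf k.
Proof.
rewrite -[leqRHS]card_ord -sum1_card; apply: leq_sum => t _; exact: A1.
Qed.

Lemma col_n q : col n q = A q.
Proof. by rewrite /col suf_n big_ord1 muln1 addn0. Qed.

Lemma key_uptoS i q z : key_upto i q.+1 z = key_upto i q z + col i.+1 (q * ms i + z).
Proof. exact: big_ord_recr. Qed.

Lemma key_upto_le i q z : i < n -> q <= pre i -> key_upto i q z <= N.
Proof.
move=> ni qi; apply: (@leq_trans (q * suf i.+1)).
  rewrite -[q in leqRHS]card_ord -sum_nat_const; apply: leq_sum => x _; exact: col_le.
rewrite -(pre_suf ni) preS leq_mul2r -[q]muln1 leq_mul ?orbT //.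
by apply: ltnW.
Qed.

Lemma key_le i z : i < n -> key i z <= N.
Proof. by move=> ni; apply: key_upto_le. Qed.

Lemma row_sum_le k q z : k < n -> z <= ms k ->
  \sum_(y < z) col k.+1 (q * ms k + y) <= N.
Proof.
move=> kn zk; apply: (@leq_trans (z * suf k.+1)).
  rewrite -[z in leqRHS]card_ord -sum_nat_const; apply: leq_sum => x _; exact: col_le.
rewrite -(pre_suf (ltnW kn)) (sufS kn).
have := leq_mul zk (leqnn (suf k.+1)); have := pre_gt0 k; nia.
Qed.

Hypothesis n2 : 2 <= n.

Lemma M_le : M <= N. Proof. by apply: off_le_pre; lia. Qed.
Lemma n_le : n.*2 <= N. Proof. exact: leq_trans (double_le_off n) M_le. Qed.

Variable W : nat.
Hypothesis W_ge : 64 * N <= W.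

Fixpoint chain (nx : nat -> nat) (h : nat) (l : seq nat) : Prop :=
  if l is x :: l' then h = x.+1 /\ chain nx (nx x) l' else h = 0.

Lemma chain_ext nx nx' h l :
  (forall x, x \in l -> nx x = nx' x) -> chain nx h l -> chain nx' h l.
Proof.
elim: l h => //= x l IH h E [-> c]; split=> //; rewrite -E ?mem_head //.
by apply: IH c => y yl; apply: E; rewrite inE yl orbT.
Qed.

(** * Array size, and counts by summing out coordinates *)

Definition has_sizes (m : nat -> nat) :=
  m 0 = n /\ forall i, i < n -> (m (i + 1)) + 1 = ms i.

Lemma sizes_wp m : has_sizes m ->
  wp W sizes_prog (100 * N) (State (fun=> 0) m)
    (fun st => [/\ Defs.mem st = m, reg st 4 = N, reg st 5 = M & reg st 6 = n]).
Proof.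
move=> [m0 mS]; have le := n_le; apply: wp_le.
- apply: (wp_assign (v := 1)) => //; first by lia.
  apply: (wp_assign (v := 0)) => //.
  apply: (wp_assign (v := 0)) => //.
  apply: wp_seq; apply: (wp_for (K := n) (Inv := fun k st =>
    [/\ Defs.mem st = m, reg st 4 = pre k, reg st 5 = off k & reg st 6 = k])).
  + move=> k [r m'] kn /= [-> r4 r5 r6]; split.
      by rewrite r6 m0 addn1 kn.
    have [a1 a2 a3] : [/\ pre k.+1 <= N, off k.+1 <= M & k < n] by rewrite pre_le ?off_le.
    have := M_le => a4.
    apply: (wp_assign (v := pre k.+1)); [ | lia | ].
      by ev; rewrite r4 r6 mS // preS.
    apply: (wp_assign (v := off k.+1)); [ | lia | ].
      by ev; rewrite r5 r6 mS // offS.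
    apply: (wp_assign (v := k.+1)); [ | lia | ].
      by ev; rewrite r6 addn1.
    apply: wp_skip; split; by ev.
  + move=> [r m'] /= [-> r4 r5 r6]; split; last by apply: wp_skip; split.
    by rewrite r6 m0 addn1 ltnn.
  + by split; ev; rewrite ?pre0 ?off0.
- rewrite /=; lia.
Qed.

(* Where [col k] is stored: [col n] is in the input, and each further array
   follows the previous one. *)
Definition src k := n.+1 + (stack n.+1 - stack k.+1).

Lemma src_n : src n = n.+1. Proof. by rewrite /src subnn addn0. Qed.

Lemma srcS k : k < n -> src k = src k.+1 + pre k.+1.
Proof.
move=> kn; rewrite /src (stackS k.+1); have := @stack_le k.+2 n.+1 kn.
rewrite (stackS k.+1); lia.
Qed.

(** The header takes n + 1 cells with 2n <= N, and the arrays together have fewer than 2N entries.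
    They therefore stay clear of the counts, stored from 4N on. *)
Lemma src_end k : k <= n -> src k + pre k <= 3 * N.
Proof.
move=> kn; have := @stack_le k.+1 n.+1 kn; have := stackS n; have := stack_lt n.
have := n_le; have := stackS k; rewrite /src; lia.
Qed.

Lemma collapse_row_wp i q r m s : i < n -> q < pre i ->
  s + ms i <= 4 * N ->
  r 4 = N -> r 5 = off i -> r 7 = s -> r 10 = 0 -> r 11 = 0 -> r 12 = ms i ->
  (forall z, z < ms i -> m (4 * N + off i + z) = key_upto i q z) ->
  (forall z, z < ms i -> m (s + z) = col i.+1 (q * ms i + z)) ->
  wp W collapse_row (60 * ms i + 60) (State r m) (fun st =>
    [/\ keeps [:: 7; 10; 11] r (reg st), reg st 7 = s + ms i,
        reg st 11 = col i q,
        forall z, z < ms i -> Defs.mem st (4 * N + off i + z) = key_upto i q.+1 z &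
        forall a, a < 4 * N + off i \/ 4 * N + off i + ms i <= a ->
          Defs.mem st a = m a]).
Proof.
move=> ni qi sN r4 r5 r7 r10 r11 r12 mS mA.
have ltM : off i + ms i <= M by rewrite -offS off_le.
have MN := M_le.
apply: wp_le; first apply: (wp_for (K := ms i) (Inv := fun k st =>
    [/\ keeps [:: 7; 10; 11] r (reg st),
       [/\ reg st 7 = s + k, reg st 10 = k &
        reg st 11 = \sum_(z < k) col i.+1 (q * ms i + z)],
        forall z, z < k -> Defs.mem st (4 * N + off i + z) = key_upto i q.+1 z &
        forall a, a < 4 * N + off i \/ 4 * N + off i + k <= a ->
          Defs.mem st a = m a])).
- move=> k [r' m'] km /= [kr [r7' r10' r11'] mS' fr].
  have [r4' r5' r12'] : [/\ r' 4 = N, r' 5 = off i & r' 12 = ms i].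
    by rewrite !kr.
  have kle := key_upto_le k ni qi; have rle := row_sum_le q ni km.
  split; first by rewrite r10' r12' addn1 km.
  apply: (wp_store (a := 4 * N + off i + k) (v := key_upto i q.+1 k)) => /=.
  + by rewrite r4' r5' r10'.
  + rewrite r4' r5' r10' r7' fr; last by lia.
    by rewrite mS // fr ?mA ?key_uptoS //; lia.
  + lia.
  + lia.
  apply: (wp_assign (v := \sum_(z < k.+1) col i.+1 (q * ms i + z))) => /=.
  + by upd; rewrite r11' big_ord_recr /= r7'; upd; rewrite fr ?mA //; lia.
  + by apply: leq_trans rle _; lia.
  apply: (wp_assign (v := s + k.+1)) => /=; [by upd; lia | lia |].
  apply: (wp_assign (v := k.+1)) => /=; [by upd; lia | lia |].
  apply: wp_skip; split=> /=.
  + by do 3 apply: keeps_upd => //.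
  + by split; upd.
  + move=> z; rewrite ltnS leq_eqVlt => /orP[/eqP->|zk]; upd => //; exact: mS'.
  + by move=> a ak; upd; apply: fr; lia.
- move=> [r' m'] /= [kr [r7' r10' r11'] mS' fr]; split.
    by rewrite r10' kr // r12 addn1 ltnn.
  by split=> //; rewrite r11' colS.
- by split=> //=; rewrite ?big_ord0 ?addn0 //; split.
- rewrite /=; lia.
Qed.

Lemma collapse_level_wp i r m : i < n ->
  r 4 = N -> r 5 = off i -> r 7 = src i.+1 -> r 8 = src i -> r 9 = src i ->
  r 12 = ms i ->
  (forall z, z < ms i -> m (4 * N + off i + z) = 0) ->
  (forall x, x < pre i.+1 -> m (src i.+1 + x) = col i.+1 x) ->
  wp W collapse_level (300 * pre i.+1) (State r m) (fun st =>
    [/\ keeps [:: 7; 9; 10; 11] r (reg st),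
        reg st 7 = src i /\ reg st 9 = src i + pre i,
        forall x, x < pre i -> Defs.mem st (src i + x) = col i x,
        forall z, z < ms i -> Defs.mem st (4 * N + off i + z) = key i z &
        forall a, a < src i \/ src i + pre i <= a /\
          (a < 4 * N + off i \/ 4 * N + off i + ms i <= a) ->
          Defs.mem st a = m a]).
Proof.
move=> ni r4 r5 r7 r8 r9 r12 mS mA.
have ltM : off i + ms i <= M by rewrite -offS off_le.
have MN := M_le; have srcE := srcS ni; have src_e := src_end (ltnW ni).
apply: wp_le; first apply: (wp_for (K := pre i) (Inv := fun q st =>
    [/\ keeps [:: 7; 9; 10; 11] r (reg st),
        reg st 7 = src i.+1 + q * ms i /\ reg st 9 = src i + q,
        forall x, x < q -> Defs.mem st (src i + x) = col i x,
        forall z, z < ms i -> Defs.mem st (4 * N + off i + z) = key_upto i q z &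
        forall a, a < src i \/ src i + pre i <= a /\
          (a < 4 * N + off i \/ 4 * N + off i + ms i <= a) ->
          Defs.mem st a = m a])).
- move=> q [r' m'] qi /= [kr [r7' r9'] mD' mS' fr].
  have [r4' r5' r12' r8'] : [/\ r' 4 = N, r' 5 = off i, r' 12 = ms i & r' 8 = src i].
    by rewrite !kr.
  have qP : q * ms i + ms i <= pre i.+1 by rewrite preS -mulSnr leq_mul2r qi orbT.
  have m_gt := ms2 i.
  split; first by rewrite r7' r8'; lia.
  apply: (wp_assign (v := 0)) => //; apply: (wp_assign (v := 0)) => //.
  apply: wp_seq; apply: wp_weaken.
  + apply: (@collapse_row_wp i q _ _ (src i.+1 + q * ms i)) => //; try by ev.
      by lia.
    by move=> z zi; rewrite -addnA fr ?mA //; lia.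
  + exact: leqnn.
  + move=> [r1 m1] /= [kr1 r17 r111 mS1 fr1].
    have rr x : x \notin [:: 7; 10; 11] -> r1 x = r' x.
      by move=> nx; rewrite kr1 //; move: nx; rewrite !inE !negb_or => /and3P[? ? ?];
         rewrite !upd_other //; apply: negbTE.
    apply: (wp_store (a := src i + q) (v := col i q)) => /=.
    * by rewrite rr.
    * by [].
    * lia.
    * by have := col_le i q; have := pre_suf (ltnW ni); have := pre_gt0 i; nia.
    apply: (wp_assign (v := src i + q.+1)) => /=; [by upd; rewrite rr // r9'; lia | lia |].
    apply: wp_skip; split=> /=.
    * apply: keeps_upd => //; apply: keeps_trans kr _.
      move=> x; rewrite !inE !negb_or => /and4P[? ? ? ?].
      by rewrite rr // !inE !negb_or; apply/and3P.
    * by split; upd; rewrite ?r17; lia.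
    * move=> x; rewrite ltnS leq_eqVlt => /orP[/eqP->|xq]; upd => //.
      by rewrite fr1 ?mD' //; lia.
    * by move=> z zi; upd; apply: mS1.
    * by move=> a Ha; upd; rewrite fr1 ?fr //; lia.
- move=> [r' m'] /= [kr [r7' r9'] mD' mS' fr]; split; last first.
    by split=> //; split=> //; rewrite r7' srcE preS.
  by rewrite r7' kr // r8 srcE preS addn1 ltnn.
- split=> //=.
  + by rewrite !addn0.
  + by move=> z zi; rewrite mS // /key_upto big_ord0.
- rewrite /= preS; have := pre_gt0 i; have := ms2 i; nia.
Qed.

Definition stores_keys (m : nat -> nat) :=
  forall i z, i < n -> z < ms i -> m (4 * N + off i + z) = key i z.

(** Only [col n] lies inside the input. The later arrays start past it, so the original array
    survives for the final rearrangement. *)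
Lemma src_gt i : i < n -> n + N < src i.
Proof.
move=> ni; have := @stack_le i.+1 n ni; have := stackS n; rewrite /src; lia.
Qed.

Lemma collapse_wp r m : r 4 = N -> r 5 = M -> r 6 = n -> has_sizes m ->
  (forall x, x < N -> m (n.+1 + x) = A x) ->
  (forall x, x < M -> m (4 * N + x) = 0) ->
  wp W collapse_prog (2000 * N) (State r m) (fun st =>
    [/\ [/\ reg st 4 = N, reg st 5 = 0 & reg st 6 = 0],
        stores_keys (Defs.mem st) &
        forall a, a <= n + N \/ 5 * N <= a -> Defs.mem st a = m a]).
Proof.
move=> r4 r5 r6 [m0 mS] mA mZ; have nN := n_le; have MN := M_le.
apply: wp_le.
  apply: (wp_assign (v := n.+1)) => /=; [by rewrite m0 addn1 | lia |].
  apply: (wp_assign (v := n.+1 + N)) => /=; [by upd; rewrite r4 | lia |].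
  (* Round [k] sums out coordinate n - k - 1, at a cost proportional to the array of size
     [pre (n - k)] that it reads; [sum_pre] bounds the total by a multiple of 2N. *)
  apply: wp_seq; apply: (wp_while (K := n) (T := fun k => 500 * pre (n - k))
    (Inv := fun k st => let i := n - k in
    [/\ [/\ reg st 4 = N, reg st 5 = off i, reg st 6 = i, reg st 7 = src i &
            reg st 9 = src i + pre i],
        forall x, x < pre i -> Defs.mem st (src i + x) = col i x,
        forall j z, i <= j -> j < n -> z < ms j ->
          Defs.mem st (4 * N + off j + z) = key j z,
        forall x, x < off i -> Defs.mem st (4 * N + x) = 0 &
        forall a, a <= n + N \/ 5 * N <= a -> Defs.mem st a = m a])).
  - move=> k [r' m'] kn; cbv zeta; have [i ni] : exists i, n - k = i.+1.
      by exists (n - k).-1; lia.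
    have -> : n - k.+1 = i by lia.
    rewrite ni => -[/= [r4' r5' r6' r7' r9'] mD mK mZ' fr].
    have {}kn : i < n by lia.
    have src_e := src_end (ltnW kn); have srcE := srcS kn; have sg := src_gt kn.
    have oM := off_le kn; have oS := offS i.
    split; first by rewrite r6'.
    apply: wp_le.
    apply: (wp_assign (v := i)) => /=; [by rewrite r6'; lia | lia |].
    apply: (wp_assign (v := ms i)) => /=.
      by upd; rewrite fr ?mS //; lia.
      by lia.
    apply: (wp_assign (v := off i)) => /=; [by upd; rewrite r5'; lia | lia |].
    apply: (wp_assign (v := src i)) => /=; [by upd; rewrite r9' srcE | lia |].
    apply: wp_seq; apply: wp_weaken.
    + apply: (@collapse_level_wp i) => //; try by ev.
        by ev; rewrite r9' srcE.
      move=> z zi; rewrite -addnA mZ' //; lia.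
    + exact: leqnn.
    + move=> [r1 m1] /= [kr1 [r17 r19] mD1 mK1 fr1].
      apply: wp_skip; split=> //=.
      * by rewrite r17 r19 !kr1 //; upd; split.
      * move=> j z; rewrite leq_eqVlt => /orP[/eqP <- _|ij jn zj]; first exact: mK1.
        rewrite fr1 ?mK //; have := off_le ij; rewrite offS; lia.
      * by move=> x xi; rewrite fr1 ?mZ' //; lia.
      * by move=> a Ha; rewrite fr1 ?fr //; lia.
    + by rewrite /=; have := pre_gt0 i.+1; lia.
  - move=> [r' m']; cbv zeta; rewrite subnn => -[/= [r4' r5' r6' r7' r9'] mD mK mZ' fr].
    split; first by rewrite r6'.
    apply: wp_skip; split=> //=; first by split=> //; rewrite r5' off0.
    by move=> j z; apply: mK.
  - cbv zeta; rewrite subn0 src_n; split=> //=.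
    + by move=> x xN; rewrite mA // col_n.
    + by move=> j z /leq_ltn_trans H /H; rewrite ltnn.
rewrite /= big_split /= sum_nat_const card_ord -big_distrr /=.
have -> : \sum_(k < n) pre (n - k) = \sum_(j < n) pre j.+1.
  rewrite [RHS](reindex_inj rev_ord_inj) /=; apply: eq_bigr => k _.
  by congr pre; have := ltn_ord k; lia.
have := sum_pre n; lia.
Qed.

(** * Bucket sort of all pairs of a direction and a strategy *)

Section Buckets.

Variable kf : nat -> nat.
Hypothesis kf_le : forall p, p < M -> kf p <= N.

(** Reversed, because a pair is inserted at the head of its linked list. *)
Definition bucket v p := [seq x <- rev (iota 0 p) | kf x == v].

Lemma bucketS v p :
  bucket v p.+1 = if kf p == v then p :: bucket v p else bucket v p.
Proof. by rewrite /bucket -addn1 iotaD rev_cat. Qed.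

Lemma mem_bucket v p x : (x \in bucket v p) = (x < p) && (kf x == v).
Proof. by rewrite mem_filter mem_rev mem_iota andbC. Qed.

Definition filled (p : nat) (m : nat -> nat) :=
  (forall v, v <= N -> chain (fun x => m (8 * N + x)) (m (6 * N + v)) (bucket v p)) /\
  (forall i z, i < n -> z < ms i -> off i + z < p ->
     m (10 * N + (off i + z)) = i /\ m (12 * N + (off i + z)) = z).

Lemma insert_level_wp i r m : i < n ->
  r 4 = N -> r 5 = off i -> r 6 = i -> r 10 = 0 -> r 12 = ms i ->
  (forall p, p < M -> m (4 * N + p) = kf p) -> filled (off i) m ->
  wp W insert_level (100 * ms i + 20) (State r m) (fun st =>
    [/\ keeps [:: 5; 10; 11] r (reg st), reg st 5 = off i.+1,
        filled (off i.+1) (Defs.mem st) &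
        forall a, a < 6 * N \/ 13 * N <= a -> Defs.mem st a = m a]).
Proof.
move=> ni r4 r5 r6 r10 r12 mK mF.
have ltM : off i + ms i <= M by rewrite -offS off_le.
have MN := M_le; have nN := n_le.
apply: wp_le; first apply: (wp_for (K := ms i) (Inv := fun k st =>
    [/\ keeps [:: 5; 10; 11] r (reg st),
        reg st 5 = off i + k /\ reg st 10 = k,
        filled (off i + k) (Defs.mem st) &
        forall a, a < 6 * N \/ 13 * N <= a -> Defs.mem st a = m a])).
- move=> k [r' m'] km /= [kr [r5' r10'] [mC mD] fr].
  have [r4' r6' r12'] : [/\ r' 4 = N, r' 6 = i & r' 12 = ms i] by rewrite !kr.
  split; first by rewrite r10' r12' addn1 km.
  set p := off i + k in r5' mC mD *; have pM : p < M by rewrite /p; lia.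
  have kp := kf_le pM; have pi : p = off i + k by [].
  apply: (wp_assign (v := 6 * N + kf p)) => /=; [|lia|].
    by rewrite r4' r5' fr ?mK //; lia.
  (* The head is 0 or x + 1 for some pair x < p, so it fits into a word. *)
  have hd_le : m' (6 * N + kf p) <= p.
    have := mC _ kp; have := fun x => mem_bucket (kf p) p x.
    case: (bucket _ p) => [|x l] /= H; first by move=> ->.
    by case=> -> _; move: (H x); rewrite mem_head; lia.
  apply: (wp_store (a := 8 * N + p) (v := m' (6 * N + kf p))) => /=;
    [by upd; lia | by upd | lia | lia |].
  apply: (wp_store (a := 6 * N + kf p) (v := p.+1)) => /=;
    [by upd | by upd; lia | lia | lia |].
  apply: (wp_store (a := 10 * N + p) (v := i)) => /=;
    [by upd; lia | by upd | lia | lia |].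
  apply: (wp_store (a := 12 * N + p) (v := k)) => /=;
    [by upd; lia | by upd | lia | lia |].
  apply: (wp_assign (v := p.+1)) => /=; [by upd; lia | lia |].
  apply: (wp_assign (v := k.+1)) => /=; [by upd; lia | lia |].
  apply: wp_skip; split=> /=.
  + by do 3 apply: keeps_upd => //.
  + by split; upd; lia.
  + rewrite addnS -/p; split.
      move=> v vN; rewrite bucketS; case: eqVneq => [<-|ne]; upd.
        split=> //; upd; apply: chain_ext (mC _ kp) => x.
        by rewrite mem_bucket => /andP[xp _]; upd.
      apply: chain_ext (mC _ vN) => x.
      by rewrite mem_bucket => /andP[xp _]; upd.
    move=> j z jn zj; rewrite ltnS leq_eqVlt => /orP[/eqP E|lt].
      have [ij kz] := off_inj zj km E; rewrite E -{}ij in pi *; subst z.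
      by split; upd.
    by have [E1 E2] := mD _ _ jn zj lt; split; upd.
  + by move=> a Ha; upd; apply: fr.
- move=> [r' m'] /= [kr [r5' r10'] mF' fr]; split.
    by rewrite r10' kr // r12 addn1 ltnn.
  by rewrite -offS in r5' mF'.
- by split=> //=; rewrite ?addn0.
- rewrite /=; lia.
Qed.

Lemma insert_wp r m : r 4 = N -> r 5 = 0 -> r 6 = 0 -> has_sizes m ->
  (forall p, p < M -> m (4 * N + p) = kf p) ->
  (forall v, v <= N -> m (6 * N + v) = 0) ->
  wp W insert_prog (400 * N) (State r m) (fun st =>
    [/\ reg st 4 = N, filled M (Defs.mem st),
        forall i, i < n -> Defs.mem st (14 * N + i) = off i &
        forall a, a < 6 * N \/ 15 * N <= a -> Defs.mem st a = m a]).
Proof.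
move=> r4 r5 r6 [m0 mS] mK mZ; have nN := n_le; have MN := M_le.
apply: wp_le.
  apply: (wp_while (K := n) (T := fun k => 200 * ms k)
    (Inv := fun k st =>
    [/\ [/\ reg st 4 = N, reg st 5 = off k & reg st 6 = k],
        filled (off k) (Defs.mem st),
        forall i, i < k -> Defs.mem st (14 * N + i) = off i &
        forall a, a < 6 * N \/ 15 * N <= a -> Defs.mem st a = m a])).
  - move=> k [r' m'] kn /= [[r4' r5' r6'] mF mO fr].
    have oM := off_le kn; have oS := offS k.
    split; first by rewrite r6' fr ?m0 ?addn1 ?kn //; lia.
    apply: wp_le.
    apply: (wp_assign (v := ms k)) => /=; [|lia|].
      by rewrite r6' fr ?mS //; lia.
    apply: (wp_store (a := 14 * N + k) (v := off k)) => /=;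
      [by upd; rewrite r4' r6' | by upd | lia | lia |].
    apply: (wp_assign (v := 0)) => //=.
    apply: wp_seq; apply: wp_weaken.
    + apply: (@insert_level_wp k) => //; try by ev.
      * by move=> p pM; upd; rewrite fr ?mK //; lia.
      * case: mF => mC mD; split=> [v vN | i z ni zi lt].
          upd; apply: chain_ext (mC _ vN) => x; rewrite mem_bucket => /andP[xk _].
          by upd.
        by have [E1 E2] := mD _ _ ni zi lt; split; upd.
    + exact: leqnn.
    + move=> [r1 m1] /= [kr1 r15 mF1 fr1].
      apply: (wp_assign (v := k.+1)) => /=; [rewrite kr1 //; upd; lia | lia |].
      apply: wp_skip; split=> //=.
      * by split; upd; rewrite ?r15 ?kr1 //; upd.
      * move=> i; rewrite ltnS leq_eqVlt => /orP[/eqP->|ik].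
          by rewrite fr1; upd => //; lia.
        by rewrite fr1; upd; rewrite ?mO //; lia.
      * by move=> a Ha; rewrite fr1; upd; rewrite ?fr //; lia.
    + by rewrite /=; have := ms2 k; lia.
  - move=> [r' m'] /= [[r4' r5' r6'] mF mO fr].
    by split=> //; rewrite r6' fr ?m0 ?addn1 ?ltnn //; lia.
  - split=> //=; rewrite ?off0 //; split=> // v vN; exact: mZ.
rewrite /= big_split /= sum_nat_const card_ord -big_distrr /= -/(off n); lia.
Qed.

(** The strategies of direction [i], in the order in which their pairs occur in [l]: this is the
    list written for direction [i] after the pairs of [l] have been placed. *)
Definition dim_proj i l := [seq x - off i | x <- l & off i <= x < off i.+1].

Definition order v := flatten [seq bucket w M | w <- iota 0 v].

Lemma orderS v : order v.+1 = order v ++ bucket v M.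
Proof. by rewrite /order -[v.+1]addn1 iotaD map_cat flatten_cat /= cats0. Qed.

Lemma order_perm v : perm_eq (order v) [seq x <- iota 0 M | kf x < v].
Proof.
elim: v => [|v IH]; first by rewrite (eq_filter (a2 := pred0)) ?filter_pred0.
rewrite orderS; apply/seq.permP => a; rewrite count_cat (seq.permP IH) /bucket !count_filter.
rewrite count_rev; elim: (iota 0 M) => //= x l <-.
rewrite ltnS; case: (a x) => /=; case: (ltngtP (kf x) v) => _ /=; lia.
Qed.

Lemma order_full : perm_eq (order N.+1) (iota 0 M).
Proof.
apply: perm_trans (order_perm _) _; rewrite (eq_in_filter (a2 := xpredT)).
  by rewrite filter_predT.
by move=> x; rewrite mem_iota => /andP[_ xM]; rewrite ltnS kf_le.
Qed.

Definition indices l := uniq l && all (fun x => x < M) l.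

Lemma order_indices v : indices (order v).
Proof.
rewrite /indices (perm_uniq (order_perm v)) filter_uniq ?iota_uniq //=.
rewrite (perm_all _ (order_perm v)); apply/allP => x.
by rewrite mem_filter mem_iota; case/and3P.
Qed.

Lemma dim_proj_uniq i l : indices l -> uniq (dim_proj i l).
Proof.
case/andP => ul _; rewrite map_inj_in_uniq ?filter_uniq // => x y.
by rewrite !mem_filter => /andP[/andP[? _] _] /andP[/andP[? _] _]; lia.
Qed.

Lemma dim_proj_size i l : indices l -> size (dim_proj i l) <= ms i.
Proof.
move/(dim_proj_uniq i) => ul; rewrite -[leqRHS](size_iota 0).
apply: uniq_leq_size => // y /mapP[x].
by rewrite mem_filter offS mem_iota => /andP[xi _] ->; lia.
Qed.

Lemma dim_proj_rcons i j z l : i < n -> j < n -> z < ms i ->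
  dim_proj j (rcons l (off i + z)) =
  if j == i then rcons (dim_proj i l) z else dim_proj j l.
Proof.
move=> ni nj zi; rewrite /dim_proj filter_rcons.
have -> : (off j <= off i + z < off j.+1) = (j == i).
  rewrite offS; apply/idP/eqP => [H | ->]; last by lia.
  have [|//||->//] := @off_inj j i (off i + z - off j) z; lia.
by case: eqVneq => // ->; rewrite map_rcons addKn.
Qed.

Lemma indices_prefix l l' : indices (l ++ l') -> indices l.
Proof. by case/andP; rewrite cat_uniq all_cat /indices => /and3P[-> _ _] /andP[->]. Qed.

Definition placed l (m : nat -> nat) := forall i, i < n ->
  m (14 * N + i) = off i + size (dim_proj i l) /\
  forall x, x < size (dim_proj i l) ->
    m (16 * N + (off i + x)) = nth 0 (dim_proj i l) x.

Lemma place_bucket_wp l b r m :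
  r 4 = N -> filled M m -> placed l m -> indices (l ++ b) ->
  chain (fun x => m (8 * N + x)) (r 11) b ->
  wp W place_bucket (100 * size b + 20) (State r m) (fun st =>
    [/\ keeps [:: 10; 11; 12; 13] r (reg st), placed (l ++ b) (Defs.mem st) &
        forall a, a < 14 * N \/ 17 * N <= a -> Defs.mem st a = m a]).
Proof.
move=> r4 [mC mD] mP ind ch; have MN := M_le; have nN := n_le.
apply: wp_le; first apply: (wp_for (K := size b) (Inv := fun k st =>
    [/\ keeps [:: 10; 11; 12; 13] r (reg st),
        chain (fun x => m (8 * N + x)) (reg st 11) (drop k b),
        placed (l ++ take k b) (Defs.mem st) &
        forall a, a < 14 * N \/ 17 * N <= a -> Defs.mem st a = m a])).
- move=> k [r' m'] kb /= [kr ch' pl fr].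
  have r4' : r' 4 = N by rewrite kr.
  move: ch'; rewrite (drop_nth 0 kb); set p := nth 0 b k => -[r11' ch'].
  have pM : p < M.
    by case/andP: ind => _ /allP; apply; rewrite mem_cat mem_nth ?orbT.
  have [i [z [ni zi pE]]] := off_split pM.
  have [mi mz] : m (10 * N + p) = i /\ m (12 * N + p) = z.
    by rewrite pE; apply: mD => //; rewrite -pE.
  set l1 := l ++ take k b in pl.
  have l1S : l ++ take k.+1 b = rcons l1 p by rewrite (take_nth 0 kb) -/p rcons_cat.
  (* There is room for one more: with [p] appended, the list of direction [i] still has distinct
     entries below [ms i]. *)
  have sz : size (dim_proj i l1) < ms i.
    have : size (dim_proj i (rcons l1 p)) <= ms i.
      apply: dim_proj_size; apply: (@indices_prefix _ (drop k.+1 b)).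
      by rewrite -l1S -catA cat_take_drop.
    by rewrite pE dim_proj_rcons // eqxx size_rcons.
  have [pi1 pi2] := pl _ ni; set sz1 := size _ in sz pi1 pi2.
  have oM := off_le ni; have oS := offS i.
  split; first by rewrite r11'.
  apply: (wp_assign (v := p)) => /=; [lia | lia |].
  apply: (wp_assign (v := i)) => /=; [by upd; rewrite r4' fr ?mi //; lia | lia |].
  apply: (wp_assign (v := off i + sz1)) => /=; [by upd; rewrite r4' | lia |].
  apply: (wp_store (a := 16 * N + (off i + sz1)) (v := z)) => /=;
    [by upd; rewrite r4' | by upd; rewrite r4' fr ?mz //; lia | lia | lia |].
  apply: (wp_store (a := 14 * N + i) (v := off i + sz1.+1)) => /=;
    [by upd; rewrite r4' | by upd; lia | lia | lia |].
  apply: (wp_assign (v := m (8 * N + p))) => /=.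
  + by upd; rewrite r4' fr //; lia.
  + have xM x : x \in b -> x < M.
      by case/andP: ind => _ /allP H xb; apply: H; rewrite mem_cat xb orbT.
    move: ch'; case E: (drop k.+1 b) => [|x d] /= => [-> // | [-> _]].
    by have := xM x (mem_drop (n0 := k.+1) _); rewrite E mem_head => /(_ isT); lia.
  apply: wp_skip; split=> //=.
  + by do 4 apply: keeps_upd => //.
  + rewrite l1S pE => j nj; rewrite dim_proj_rcons //.
    have oMj := off_le nj; have oSj := offS j.
    case: eqVneq => [->|ne]; last first.
      have [pj1 pj2] := pl _ nj; split; first by upd; rewrite pj1.
      have szj : size (dim_proj j l1) <= ms j.
        apply: dim_proj_size; apply: (@indices_prefix _ (drop k b)).
        by rewrite -catA cat_take_drop.
      (* Both lists fit into the blocks of their directions, so the cell written for [i] lies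
         outside the list of [j]. *)
      move=> x xs; have neq : (off j + x == off i + sz1) = false.
        by apply/eqP => /off_inj[|//|E _]; [lia | rewrite E eqxx in ne].
      by upd; apply: pj2.
    rewrite size_rcons -/sz1; split; first by upd.
    move=> x; rewrite ltnS nth_rcons -/sz1 leq_eqVlt => /orP[/eqP->|xs].
      by rewrite ltnn eqxx; upd.
    by rewrite xs; upd; apply: pi2.
  + by move=> a Ha; upd; apply: fr.
- move=> [r' m'] /= [kr]; rewrite drop_size take_size => ch' pl fr.
  by split.
- split=> //=; by rewrite ?drop0 ?take0 ?cats0.
- rewrite /=; lia.
Qed.

Lemma place_wp r m : r 4 = N -> filled M m ->
  (forall i, i < n -> m (14 * N + i) = off i) ->
  wp W place_prog (500 * N) (State r m) (fun st =>
    [/\ reg st 4 = N, placed (order N.+1) (Defs.mem st) &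
        forall a, a < 14 * N \/ 17 * N <= a -> Defs.mem st a = m a]).
Proof.
move=> r4 mF mO; have MN := M_le; have nN := n_le; have [mC mD] := mF.
apply: wp_le.
  apply: (wp_assign (v := 0)) => //=.
  (* Counts range over 0, ..., N, hence N + 1 buckets. Each round is charged by the size of its
     bucket, and the sizes add up to M. *)
  apply: (wp_while (K := N.+1) (T := fun v => 100 * size (bucket v M) + 50)
    (Inv := fun v st =>
    [/\ reg st 4 = N /\ reg st 6 = v, placed (order v) (Defs.mem st) &
        forall a, a < 14 * N \/ 17 * N <= a -> Defs.mem st a = m a])).
  - move=> v [r' m'] vN /= [[r4' r6'] pl fr].
    have fM : filled M m'.
      split=> [w wN | i z ni zi lt].
        rewrite fr; last by lia.
        apply: chain_ext (mC _ wN) => x; rewrite mem_bucket => /andP[xM _].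
        by rewrite fr //; lia.
      by rewrite !fr; [exact: mD | lia | lia].
    split; first by rewrite r4' r6' -ltnS vN.
    apply: wp_le.
    apply: (wp_assign (v := m' (6 * N + v))) => /=; first by rewrite r4' r6'.
      rewrite fr; last by lia.
      have := mC v vN; have := fun x => mem_bucket v M x.
      case: (bucket _ _) => [|x l] /= H; first by move=> ->.
      by case=> -> _; move: (H x); rewrite mem_head; lia.
    apply: wp_seq; apply: wp_weaken.
    + apply: (@place_bucket_wp (order v) (bucket v M)) => //; try by ev.
        by rewrite -orderS; apply: order_indices.
      by upd; have [mC' _] := fM; apply: mC'.
    + exact: leqnn.
    + move=> [r1 m1] /= [kr1 pl1 fr1].
      apply: (wp_assign (v := v.+1)) => /=; [rewrite kr1 //; upd; lia | lia |].
      apply: wp_skip; split=> //=.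
      * by split; upd; rewrite ?kr1 //; upd.
      * by rewrite orderS.
      * by move=> a Ha; rewrite fr1 ?fr.
    + rewrite /=; lia.
  - by move=> [r' m'] /= [[r4' r6'] pl fr]; split=> //; rewrite r4' r6' ltnn.
  - split=> //= i ni; split=> //; rewrite mO // /dim_proj /order /=; lia.
have -> : \sum_(k < N.+1) (100 * size (bucket k M) + 50 + (expr_cost ($6 <= $4)).+1)
   = 100 * size (order N.+1) + N.+1 * (50 + (expr_cost ($6 <= $4)).+1).
  under eq_bigr => k _ do rewrite -addnA.
  rewrite big_split /= sum_nat_const card_ord -big_distrr /=; congr (_ * _ + _).
  elim: (N.+1) => [|k IH]; first by rewrite big_ord0.
  by rewrite big_ord_recr /= IH orderS size_cat.
rewrite (perm_size order_full) size_iota /=; lia.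
Qed.

Definition sorting i z := nth 0 (dim_proj i (order N.+1)) z.

Lemma dim_proj_full i : i < n -> perm_eq (dim_proj i (order N.+1)) (iota 0 (ms i)).
Proof.
move=> ni; apply: uniq_perm; rewrite ?iota_uniq //.
  exact/dim_proj_uniq/order_indices.
move=> z; rewrite mem_iota; apply/mapP/idP => [[x] | /= zi].
  by rewrite mem_filter offS => /andP[xi _] ->; lia.
exists (off i + z); last by lia.
have oM := off_le ni; rewrite mem_filter (perm_mem order_full) mem_iota.
by rewrite offS in oM *; lia.
Qed.

Lemma sorting_lt i z : i < n -> z < ms i -> sorting i z < ms i.
Proof.
move=> ni zi; have /perm_size := dim_proj_full ni; rewrite size_iota => sz.
have /perm_mem/(_ (sorting i z)) := dim_proj_full ni.
by rewrite mem_nth ?sz // mem_iota => /esym/andP[].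
Qed.

Lemma sorting_inj i y z : i < n -> y < ms i -> z < ms i ->
  sorting i y = sorting i z -> y = z.
Proof.
move=> ni yi zi /eqP; have /perm_size := dim_proj_full ni; rewrite size_iota => sz.
rewrite nth_uniq ?sz // => [/eqP //|]; exact/dim_proj_uniq/order_indices.
Qed.

(** Stated with [pairwise], which passes directly to the subsequence of the pairs of one
    direction. *)
Lemma order_pairwise v : pairwise (fun x y => kf x <= kf y) (order v).
Proof.
elim: v => // v IH; rewrite orderS pairwise_cat IH /=; apply/andP; split.
  apply/allrelP => x y; rewrite (perm_mem (order_perm v)) mem_bucket mem_filter.
  by move=> /andP[xv _] /andP[_ /eqP ->]; apply: ltnW.
apply/(pairwiseP 0) => i j; rewrite !inE => si sj _.
have E k : k < size (bucket v M) -> kf (nth 0 (bucket v M) k) = v.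
  by move=> /(mem_nth 0); rewrite mem_bucket => /andP[_ /eqP].
by rewrite !E.
Qed.

Lemma sorting_mono i y z : i < n -> y <= z -> z < ms i ->
  kf (off i + sorting i y) <= kf (off i + sorting i z).
Proof.
move=> ni; rewrite leq_eqVlt => /orP[/eqP-> //|yz zi].
have /perm_size := dim_proj_full ni; rewrite size_iota => sz.
have : pairwise (fun x y => kf (off i + x) <= kf (off i + y)) (dim_proj i (order N.+1)).
  rewrite pairwise_map.
  have := subseq_pairwise (filter_subseq _ _) (order_pairwise N.+1).
  move=> /(_ (fun x => off i <= x < off i.+1)).
  set l := filter _ _; have : all (fun x => off i <= x) l.
    by apply/allP => x; rewrite mem_filter => /andP[/andP[]].
  elim: l => //= x l IH /andP[xi li] /andP[al pw].
  rewrite IH // andbT; apply/allP => w wl /=.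
  by rewrite !subnKC ?(allP al) // (allP li).
by move=> /(pairwiseP 0)/(_ y z); apply; rewrite ?inE ?sz //; apply: ltn_trans zi.
Qed.

End Buckets.

(** * Relabeled positions and coordinate sums of prefixes, and the check *)

Section Expansion.

Variable p : nat -> nat -> nat.
Hypothesis p_lt : forall i z, i < n -> z < ms i -> p i z < ms i.

(** The frame covers level [k] of both stacks and the sorted lists, which are still being read while
    level [k.+1] is written. *)
Definition expanded k c (m m' : nat -> nat) :=
  (forall x, x < c ->
     m' (18 * N + (stack k.+1 + x)) = relabeled p k.+1 x /\
     m' (20 * N + (stack k.+1 + x)) = digit_sum k.+1 x) /\
  (forall a, [\/ a < 18 * N + stack k.+1,
                 18 * N + stack k.+2 <= a < 20 * N + stack k.+1 |
                 20 * N + stack k.+2 <= a] -> m' a = m a).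

Lemma expanded_step k c m m' : k < n -> c < pre k.+1 -> expanded k c m m' ->
  expanded k c.+1 m
    (update (update m' (18 * N + (stack k.+1 + c)) (relabeled p k.+1 c))
       (20 * N + (stack k.+1 + c)) (digit_sum k.+1 c)).
Proof.
move=> kn cP [E F]; have sS := stackS k.+1.
have := @stack_le k.+2 n.+1 kn; have := stackS n; have := stack_lt n => ? ? ?.
split=> [x | a Ha]; last by rewrite -F //; case: Ha => Ha; upd.
rewrite ltnS leq_eqVlt => /orP[/eqP->|xc]; first by upd.
by have [E1 E2] := E x xc; split; upd.
Qed.

Lemma expand_row_wp k q r m m0 : k < n -> q < pre k ->
  r 4 = N -> r 5 = off k -> r 7 = stack k + q -> r 9 = stack k.+1 + q * ms k ->
  r 10 = 0 -> r 12 = ms k ->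
  (forall z, z < ms k -> m0 (16 * N + (off k + z)) = p k z) ->
  m0 (18 * N + (stack k + q)) = relabeled p k q ->
  m0 (20 * N + (stack k + q)) = digit_sum k q ->
  expanded k (q * ms k) m0 m ->
  wp W expand_row (80 * ms k + 20) (State r m) (fun st =>
    [/\ keeps [:: 9; 10] r (reg st), reg st 9 = stack k.+1 + q.+1 * ms k &
        expanded k (q.+1 * ms k) m0 (Defs.mem st)]).
Proof.
move=> kn qk r4 r5 r7 r9 r10 r12 mp mT mU mE.
have MN := M_le; have nN := n_le; have oM := off_le kn; have oS := offS k.
have sS := stackS k; have sSS := stackS k.+1; have pS := preS k.
have := @stack_le k.+2 n.+1 kn; have := stackS n; have := stack_lt n => ? ? ?.
have qP : q * ms k + ms k <= pre k.+1 by rewrite preS -mulSnr leq_mul2r qk orbT.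
apply: wp_le; first apply: (wp_for (K := ms k) (Inv := fun z st =>
    [/\ keeps [:: 9; 10] r (reg st),
        reg st 9 = stack k.+1 + (q * ms k + z) /\ reg st 10 = z &
        expanded k (q * ms k + z) m0 (Defs.mem st)])).
- move=> z [r' m'] zk /= [kr [r9' r10'] ex].
  have [r4' r5' r7' r12'] : [/\ r' 4 = N, r' 5 = off k, r' 7 = stack k + q & r' 12 = ms k].
    by rewrite !kr.
  have [_ fr] := ex; set c := q * ms k + z in r9' ex *.
  have cP : c < pre k.+1 by rewrite /c; lia.
  have ES := expanded_step kn cP ex.
  have rl := relabeled_lt c (fun i z ik => p_lt (leq_trans ik kn)); have dl := digit_sum_le k.+1 c.
  have ple := pre_le kn; have zc : c.+1 = q * ms k + z.+1 by rewrite /c; lia.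
  split; first by rewrite r10' r12' addn1 zk.
  apply: (wp_store (a := 18 * N + (stack k.+1 + c)) (v := relabeled p k.+1 c)) => /=.
  + by rewrite r4' r9'.
  + rewrite r4' r5' r7' r10' r12' !fr; [|constructor; lia|constructor; lia].
    by rewrite mT -addnA mp // /c relabeledS.
  + lia.
  + lia.
  apply: (wp_store (a := 20 * N + (stack k.+1 + c)) (v := digit_sum k.+1 c)) => /=.
  + by rewrite r4' r9'.
  + rewrite r4' r7' r10'; upd; rewrite fr; last by constructor 2; lia.
    by rewrite mU /c digit_sumS.
  + lia.
  + lia.
  apply: (wp_assign (v := stack k.+1 + (q * ms k + z.+1))) => /=; [by upd; lia | lia |].
  apply: (wp_assign (v := z.+1)) => /=; [by upd; lia | lia |].
  apply: wp_skip; split=> /=.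
  + by do 2 apply: keeps_upd => //.
  + by split; upd.
  + by rewrite -zc.
- move=> [r' m'] /= [kr [r9' r10'] ex]; split.
    by rewrite r10' kr // r12 addn1 ltnn.
  by rewrite mulSnr.
- by rewrite /= addn0; split.
- rewrite /=; lia.
Qed.

Lemma expand_level_wp k r m : k < n ->
  r 4 = N -> r 5 = off k -> r 7 = stack k -> r 8 = stack k.+1 ->
  r 9 = stack k.+1 -> r 12 = ms k ->
  (forall z, z < ms k -> m (16 * N + (off k + z)) = p k z) ->
  (forall x, x < pre k -> m (18 * N + (stack k + x)) = relabeled p k x /\
     m (20 * N + (stack k + x)) = digit_sum k x) ->
  wp W expand_level (300 * pre k.+1) (State r m) (fun st =>
    [/\ keeps [:: 7; 9; 10] r (reg st),
        reg st 7 = stack k.+1 /\ reg st 9 = stack k.+2 &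
        expanded k (pre k.+1) m (Defs.mem st)]).
Proof.
move=> kn r4 r5 r7 r8 r9 r12 mp mT.
have sS := stackS k; have sSS := stackS k.+1; have pS := preS k.
have := @stack_le k.+2 n.+1 kn; have := stackS n; have := stack_lt n => ? ? ?.
apply: wp_le; first apply: (wp_for (K := pre k) (Inv := fun q st =>
    [/\ keeps [:: 7; 9; 10] r (reg st),
        reg st 7 = stack k + q /\ reg st 9 = stack k.+1 + q * ms k &
        expanded k (q * ms k) m (Defs.mem st)])).
- move=> q [r' m'] qk /= [kr [r7' r9'] ex].
  have [r4' r5' r8' r12'] : [/\ r' 4 = N, r' 5 = off k, r' 8 = stack k.+1 & r' 12 = ms k].
    by rewrite !kr.
  split; first by rewrite r7' r8'; lia.
  apply: (wp_assign (v := 0)) => //=.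
  apply: wp_seq; apply: wp_weaken.
  + have [mTq mUq] := mT q qk.
    by apply: (@expand_row_wp k q _ _ m) => //; ev.
  + exact: leqnn.
  + move=> [r1 m1] /= [kr1 r19 ex1].
    apply: (wp_assign (v := stack k + q.+1)) => /=; [rewrite kr1 //; upd; lia | lia |].
    apply: wp_skip; split=> //=.
    apply: keeps_upd => //; apply: (keeps_trans kr).
    apply: (@keeps_trans _ _ (update r' 10 0)); first exact: keeps_upd.
    by apply: keeps_sub kr1 => x; rewrite !inE => /orP[] ->; rewrite ?orbT.
- move=> [r' m'] /= [kr [r7' r9'] ex].
  split; first by rewrite r7' kr // r8; lia.
  by split; rewrite ?r7' ?r9' ?pS // sSS pS.
- by split=> //=; rewrite !addn0.
- rewrite /= preS; have := pre_gt0 k; have := ms2 k; nia.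
Qed.

(** Since [stack n.+1] is below 2N, the two stacks fit between 18N and 20N and between 20N and 22N.
    Register 7 ends at the start of the last level, which holds complete profiles. *)
Lemma expand_wp r m : r 4 = N -> has_sizes m ->
  (forall i z, i < n -> z < ms i -> m (16 * N + (off i + z)) = p i z) ->
  wp W expand_prog (2000 * N) (State r m) (fun st =>
    [/\ [/\ reg st 4 = N, reg st 5 = M & reg st 7 = stack n],
        forall x, x < N ->
          Defs.mem st (18 * N + (stack n + x)) = relabeled p n x /\
          Defs.mem st (20 * N + (stack n + x)) = digit_sum n x &
        forall a, a < 18 * N \/ 22 * N <= a -> Defs.mem st a = m a]).
Proof.
move=> r4 [m0 mS] mp; have nN := n_le; have MN := M_le.
have := stackS n; have := stack_lt n => ? ?.
apply: wp_le.
  apply: (wp_assign (v := 0)) => //=; apply: (wp_assign (v := 0)) => //=.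
  apply: (wp_assign (v := 0)) => //=; apply: (wp_assign (v := 1)) => //=; first by lia.
  apply: (wp_store (a := 18 * N) (v := 0)) => //=; [by upd; rewrite r4 | lia |].
  apply: (wp_store (a := 20 * N) (v := 0)) => //=; [by upd; rewrite r4 | lia |].
  apply: (wp_while (K := n) (T := fun k => 400 * pre k.+1)
    (Inv := fun k st =>
    [/\ [/\ reg st 4 = N, reg st 5 = off k, reg st 6 = k, reg st 7 = stack k &
            reg st 9 = stack k.+1],
        forall x, x < pre k ->
          Defs.mem st (18 * N + (stack k + x)) = relabeled p k x /\
          Defs.mem st (20 * N + (stack k + x)) = digit_sum k x &
        forall a, a < 18 * N \/ 22 * N <= a -> Defs.mem st a = m a])).
  - move=> k [r' m'] kn /= [[r4' r5' r6' r7' r9'] mT fr].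
    have sS := stackS k; have sSS := stackS k.+1; have sle := @stack_le k.+2 n.+1 kn.
    have oM := off_le kn; have oS := offS k.
    split; first by rewrite r6' fr ?m0 ?addn1 ?kn //; lia.
    apply: wp_le.
    apply: (wp_assign (v := ms k)) => /=; [|lia|].
      by rewrite r6' fr ?mS //; lia.
    apply: (wp_assign (v := stack k.+1)) => /=; [by upd | lia |].
    apply: wp_seq; apply: wp_weaken.
    + apply: (@expand_level_wp k) => //; try by ev.
      by move=> z zk; rewrite fr ?mp //; lia.
    + exact: leqnn.
    + move=> [r1 m1] /= [kr1 [r17 r19] [ex1 fr1]].
      apply: (wp_assign (v := off k.+1)) => /=; [rewrite !kr1 //; upd; lia | lia |].
      apply: (wp_assign (v := k.+1)) => /=; [upd; rewrite !kr1 //; upd; lia | lia |].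
      apply: wp_skip; split=> //=.
      * by split; upd; rewrite ?r17 ?r19 ?kr1 //; upd.
      * move=> a Ha; rewrite fr1 ?fr //.
        by case: Ha => Ha; [constructor 1 | constructor 3]; lia.
    + by rewrite /=; have := pre_gt0 k.+1; lia.
  - move=> [r' m'] /= [[r4' r5' r6' r7' r9'] mT fr].
    by split=> //; rewrite r6' fr ?m0 ?addn1 ?ltnn //; lia.
  - rewrite /= pre0; split=> //=.
    + by split; upd; rewrite ?off0 /stack ?big_ord0 ?big_ord_recr ?big_ord0 //= pre0.
    + case=> // _; rewrite /stack /digit_sum !big_ord0 /relabeled /=.
      by rewrite !addn0; upd.
    + by move=> a Ha; upd.
rewrite /= big_split /= sum_nat_const card_ord -big_distrr /=.
set S := bigop _ _ _; have : S <= N.*2 by exact: sum_pre.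
lia.
Qed.

(** This is [admissible] in terms of what the registers hold, with M - n in place of sigma. *)
Definition consistent x : bool :=
  if A (relabeled p n x) == 0 then 2 * digit_sum n x <= M - n
  else M - n <= 2 * digit_sum n x.

Lemma check_wp r m : r 4 = N -> r 5 = M -> r 7 = stack n -> m 0 = n ->
  (forall x, x < N -> m (n.+1 + x) = A x) ->
  (forall x, x < N ->
     m (18 * N + (stack n + x)) = relabeled p n x /\
     m (20 * N + (stack n + x)) = digit_sum n x) ->
  wp W check_prog (100 * N) (State r m) (fun st =>
    [/\ [/\ reg st 0 = all consistent (iota 0 N), reg st 1 = 4 * N,
            reg st 2 = 16 * N & reg st 3 = 22 * N],
        forall x, x < N -> Defs.mem st (22 * N + x) = A (relabeled p n x) &
        forall a, a < 22 * N -> Defs.mem st a = m a]).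
Proof.
move=> r4 r5 r7 m0 mA mT; have nN := n_le; have MN := M_le.
have sn := stack_lt n.
apply: wp_le.
  apply: (wp_assign (v := 1)) => //=; first by lia.
  apply: (wp_assign (v := 0)) => //=.
  apply: wp_seq; apply: (wp_for (K := N) (Inv := fun k st =>
    [/\ [/\ reg st 0 = all consistent (iota 0 k), reg st 6 = k, reg st 4 = N,
            reg st 5 = M & reg st 7 = stack n],
        forall x, x < k -> Defs.mem st (22 * N + x) = A (relabeled p n x) &
        forall a, a < 22 * N -> Defs.mem st a = m a])).
  - move=> k [r' m'] kN /= [[r0' r6' r4' r5' r7'] mO fr].
    have [T1 U1] := mT k kN; have tl := relabeled_lt k p_lt.
    have ul := digit_sum_le n k; have a1 := A1 (relabeled p n k).
    have allS : all consistent (iota 0 k.+1) = all consistent (iota 0 k) * consistent k :> nat.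
      by rewrite -[k.+1]addn1 iotaD all_cat mulnb /= andbT.
    split; first by rewrite r6' r4' addn1 kN.
    apply: (wp_assign (v := A (relabeled p n k))) => /=; [|lia|].
      rewrite r4' r7' r6' (fr 0) ?m0; last by lia.
      have -> : m' (18 * N + stack n + k) = relabeled p n k by rewrite -addnA fr ?T1 //; lia.
      by rewrite fr ?addn1 ?mA //; lia.
    apply: (wp_store (a := 22 * N + k) (v := A (relabeled p n k))) => /=;
      [by upd; rewrite r4' r6' | by upd | lia | lia |].
    apply: (wp_assign (v := 2 * digit_sum n k)) => /=; [|lia|].
      by upd; rewrite r4' r7' r6' -addnA fr ?U1 //; lia.
    apply: (wp_assign (v := all consistent (iota 0 k) * consistent k)) => /=.
    + upd; rewrite r0' r5' fr ?m0; last by lia.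
      congr (_ * _).
      rewrite /consistent; case: (A _) a1 => [|[|//]] _ /=; lia.
    + by case: (all _ _); case: (consistent k) => /=; lia.
    apply: (wp_assign (v := k.+1)) => /=; [by upd; lia | lia |].
    apply: wp_skip; split.
    + by rewrite allS; split; ev.
    + move=> x /=; rewrite ltnS leq_eqVlt => /orP[/eqP->|xk]; upd => //; exact: mO.
    + rewrite /=; by move=> a Ha; upd; apply: fr.
  - move=> [r' m'] /= [[r0' r6' r4' r5' r7'] mO fr].
    split; first by rewrite r6' r4' addn1 ltnn.
    apply: (wp_assign (v := 4 * N)) => /=; [by upd; rewrite r4' | lia |].
    apply: (wp_assign (v := 16 * N)) => /=; [by upd; rewrite r4' | lia |].
    apply: (wp_assign (v := 22 * N)) => /=; [by upd; rewrite r4' | lia |].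
    by apply: wp_skip; split=> //=; split; upd.
  - by split=> //=; split; upd.
rewrite /=; lia.
Qed.

End Expansion.

(** * Composition of the phases *)

Definition solution (p : nat -> nat -> nat) (st : state) :=
  [/\ forall i z, i < n -> z < ms i -> p i z < ms i,
      forall i y z, i < n -> y < ms i -> z < ms i -> p i y = p i z -> y = z &
      forall i y z, i < n -> y <= z -> z < ms i -> key i (p i y) <= key i (p i z)] /\
  [/\ [/\ reg st 0 = all (consistent p) (iota 0 N), reg st 1 = 4 * N,
          reg st 2 = 16 * N & reg st 3 = 22 * N],
      stores_keys (Defs.mem st),
      forall i z, i < n -> z < ms i ->
        Defs.mem st (16 * N + (off i + z)) = p i z &
      forall x, x < N -> Defs.mem st (22 * N + x) = A (relabeled p n x)].

(** Memory past the input is initially 0, which initializes the counts and the bucket heads. The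
    bounds of the phases add up to 5100 N; the sequencing steps fit into the remainder. *)
Lemma main_wp m : has_sizes m -> (forall x, x < N -> m (n.+1 + x) = A x) ->
  (forall a, n.+1 + N <= a -> m a = 0) ->
  wp W main_prog (6 * (1000 * N)) (State (fun=> 0) m)
    (fun st => exists p, solution p st).
Proof.
move=> mS mA mZ; have nN := n_le; have MN := M_le.
have sizes_frame m' : (forall a, a <= n + N -> m' a = m a) -> has_sizes m'.
  by case: mS => m0 mS fr; split=> [|i ni]; rewrite fr ?mS //; lia.
apply: wp_le.
  apply: wp_seq; apply: wp_weaken; [exact: sizes_wp mS | exact: leqnn |].
  move=> [r1 m1] /= [-> {m1} r14 r15 r16].
  apply: wp_seq; apply: wp_weaken; [apply: (collapse_wp r14 r15 r16 mS mA) | exact: leqnn |].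
    by move=> x xM; apply: mZ; lia.
  move=> [r2 m2] /= [[r24 r25 r26] mK fr2].
  pose kf x := m2 (4 * N + x).
  have kf_le p : p < M -> kf p <= N.
    by move=> /off_split[i [z [ni zi ->]]]; rewrite /kf addnA mK // key_le.
  apply: wp_seq; apply: wp_weaken;
    [apply: (@insert_wp kf kf_le _ m2 r24 r25 r26) => // | exact: leqnn |].
      by apply: sizes_frame => a Ha; apply: fr2; lia.
    by move=> v vN; rewrite fr2 ?mZ //; lia.
  move=> [r3 m3] /= [r34 mF mO fr3].
  apply: wp_seq; apply: wp_weaken;
    [exact: (place_wp kf_le r34 mF mO) | exact: leqnn |].
  move=> [r4 m4] /= [r44 pl fr4].
  set p := sorting kf.
  have p_lt i z : i < n -> z < ms i -> p i z < ms i by exact: sorting_lt.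
  have mP i z : i < n -> z < ms i -> m4 (16 * N + (off i + z)) = p i z.
    move=> ni zi; have [_ ->] := pl i ni => //.
    by rewrite (perm_size (dim_proj_full kf_le ni)) size_iota.
  have S4 : has_sizes m4.
    by apply: sizes_frame => a Ha; rewrite fr4 ?fr3 ?fr2 //; lia.
  apply: wp_seq; apply: wp_weaken;
    [exact: (expand_wp p_lt r44 S4 mP) | exact: leqnn |].
  move=> [r5 m5] /= [[r54 r55 r57] mT fr5].
  apply: wp_weaken; [apply: (check_wp p_lt r54 r55 r57) | exact: leqnn |].
  - by rewrite fr5; [case: S4 | lia].
  - by move=> x xN; rewrite fr5 ?fr4 ?fr3 ?fr2 ?mA //; lia.
  - exact: mT.
  move=> [r6 m6] /= [r6P mO6 fr6]; exists p; split.
    split=> // [i y z ni yi zi | i y z ni yz zi].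
      exact: sorting_inj.
    have := sorting_mono kf_le ni yz zi; rewrite -/p /kf !addnA !mK ?p_lt //.
    exact: leq_ltn_trans zi.
  split=> //= i z ni zi.
    have := off_le ni; rewrite offS => oM.
    by rewrite fr6 ?fr5 ?fr4 ?fr3 ?mK //; lia.
  have := off_le ni; rewrite offS => oM.
  by rewrite fr6 ?fr5 ?mP //; lia.
rewrite /=; lia.
Qed.

End MixedRadix.

(** * From the program to voting forms *)

Section Correctness.

Variables (n : nat) (alpha : 'I_n -> nat) (g : voting_form alpha).
Hypotheses (n2 : 2 <= n) (alpha1 : forall i, 1 <= alpha i).

(** The default 1 gives [ms j] = 2 past the last coordinate, so that all factors are at least 2
    without a range condition. *)
Definition ms j := (nth 1 [seq alpha i | i <- enum 'I_n] j).+1.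
Definition entry q := nth 0 (array_of g) q.

Lemma ms_ord (i : 'I_n) : ms i = (alpha i).+1.
Proof. by rewrite /ms (nth_map i) ?size_enum_ord // nth_ord_enum. Qed.

Lemma ms_ge2 j : 2 <= ms j.
Proof.
rewrite ltnS; case: (ltnP j n) => [jn | nj]; last first.
  by rewrite nth_default // size_map size_enum_ord.
by have := ms_ord (Ordinal jn); rewrite /ms => -[->].
Qed.

Local Notation N := (pre ms n).

Lemma table_sizeE : table_size alpha = N.
Proof. by apply: eq_bigr => i _; rewrite ms_ord. Qed.

Lemma off_sigma : off ms n = sigma alpha + n.
Proof.
have -> : off ms n = \sum_i (alpha i + 1).
  by apply: eq_bigr => i _; rewrite ms_ord addn1.
by rewrite big_split /= sum1_card card_ord.
Qed.

Lemma entryE q : q < N -> entry q = g (profile_at alpha q).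
Proof.
rewrite -table_sizeE => qN; rewrite /entry nth_mkseq // eq_cand_a //.
Qed.

Lemma entry_le1 q : entry q <= 1.
Proof.
case: (ltnP q N) => qN; first by rewrite entryE //; case: (g _).
by rewrite /entry nth_default // size_mkseq table_sizeE.
Qed.

Lemma strideE (i : 'I_n) : stride alpha i = \prod_(i.+1 <= l < n) ms l.
Proof.
rewrite big_geq_mkord; apply: eq_big => // j _; by rewrite ms_ord.
Qed.

Lemma profile_at_dig q (i : 'I_n) : profile_at alpha q i = dig ms n q i :> nat.
Proof. by rewrite ffunE /= strideE /dig ms_ord. Qed.

Definition coords (x : profile alpha) j := nth 0 [seq val (x i) | i <- enum 'I_n] j.

Lemma coords_ord (x : profile alpha) (i : 'I_n) : coords x i = x i.
Proof. by rewrite /coords (nth_map i) ?size_enum_ord // nth_ord_enum. Qed.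

Lemma coords_lt x j : j < n -> coords x j < ms j.
Proof.
by move=> jn; have := coords_ord x (Ordinal jn); rewrite (ms_ord (Ordinal jn)) => /= ->.
Qed.

Definition rank x := horner_index ms n (coords x).

Lemma rank_lt x : rank x < N.
Proof. by apply: horner_index_lt => j; apply: coords_lt. Qed.

Lemma rankK x : profile_at alpha (rank x) = x.
Proof.
apply/ffunP => i; apply: val_inj; rewrite /= profile_at_dig.
by rewrite (dig_horner ms_ge2) ?coords_ord // => j; apply: coords_lt.
Qed.

Lemma profile_atK q : q < N -> rank (profile_at alpha q) = q.
Proof.
move=> qN; rewrite -[RHS](horner_dig ms_ge2 qN); apply: eq_horner_index => j jn.
by rewrite (coords_ord _ (Ordinal jn)) profile_at_dig.
Qed.

Lemma sum_profiles (F : profile alpha -> nat) :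
  \sum_x F x = \sum_(q < N) F (profile_at alpha q).
Proof.
rewrite (reindex (fun q : 'I_N => profile_at alpha q)) //; apply: onW_bij.
exists (fun x => Ordinal (rank_lt x)) => [q | x]; last exact: rankK.
by apply: val_inj; apply: profile_atK.
Qed.

(** A position is written (x * [ms i] + y) * Q + t, where x encodes the coordinates before [i] and t
    those after it. Its digit [i] is y, so only the block y = z contributes. *)
Lemma s_key (i : 'I_n) (z : strat alpha i) :
  s g z cand_a = key ms n entry i z.
Proof.
rewrite card_plane -sum1_card big_mkcond /= sum_profiles.
have NE : N = pre ms i * ms i * suf ms n i.+1.
  by rewrite -preS pre_suf.
transitivity (\sum_(q < N) (dig ms n q i == z) * entry q).
  apply: eq_bigr => q _; rewrite inE entryE // -profile_at_dig -val_eqE /=.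
  by case: eqP => //; case: (g _).
set Q := suf ms n i.+1 in NE *; pose F q := (dig ms n q i == z) * entry q.
rewrite NE (sum_block _ _ F) (sum_block _ _ (fun y => \sum_(t < Q) F (y * Q + t))).
rewrite {}/F /key /key_upto /col -/Q.
apply: eq_bigr => x _; have zi : z < ms i by rewrite ms_ord.
have Q_gt0 : 0 < Q by move: (pre_gt0 ms_ge2 n); rewrite NE; case: (Q); rewrite ?muln0.
have digE y (t : 'I_Q) : y < ms i ->
    dig ms n ((x * ms i + y) * Q + t) i = y.
  by move=> yi; rewrite /dig -/(suf ms n i.+1) -/Q divnMDl // divn_small // addn0
    modnMDl modn_small.
rewrite (bigD1 (Ordinal zi)) //= [X in _ + X]big1 => [|y ne].
  by rewrite addn0; apply: eq_bigr => t _; rewrite digE // eqxx mul1n.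
by apply: big1 => t _; rewrite digE // -val_eqE /= in ne *; rewrite (negbTE ne).
Qed.

Lemma mkseq_blocks (F : nat -> nat) k :
  mkseq F (off ms k) =
  flatten [seq mkseq (fun z => F (off ms i + z)) (ms i) | i <- iota 0 k].
Proof.
elim: k => [|k IH]; first by rewrite off0.
rewrite offS -[k.+1]addn1 [in RHS]iotaD map_cat flatten_cat -IH /= cats0.
rewrite /mkseq iotaD map_cat add0n; congr (_ ++ _).
by rewrite -[off ms k in LHS]addn0 iotaDl -map_comp.
Qed.

Lemma stored_per_plane m b (f : forall i : 'I_n, strat alpha i -> nat) :
  (forall (i : 'I_n) (z : strat alpha i), m (b + (off ms i + z)) = f i z) ->
  stored_at m b (per_plane f).
Proof.
move=> E; suff -> : per_plane f = mkseq (fun j => m (b + j)) (off ms n).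
  by rewrite /stored_at size_mkseq.
rewrite mkseq_blocks /per_plane -val_enum_ord -map_comp; congr flatten.
apply: eq_map => i /=; rewrite ms_ord /mkseq -val_enum_ord -map_comp.
by apply: eq_map => z /=.
Qed.

Lemma stored_array (m : nat -> nat) b (h : voting_form alpha) :
  (forall q, q < N -> m (b + q) = h (profile_at alpha q)) ->
  stored_at m b (array_of h).
Proof.
move=> E; rewrite /stored_at size_mkseq; apply/eq_in_map => q.
by rewrite mem_iota table_sizeE => /= qN; rewrite E // eq_cand_a.
Qed.

Section Relabeling.

Variable p : nat -> nat -> nat.
Hypothesis p_lt : forall i z, i < n -> z < ms i -> p i z < ms i.
Hypothesis p_inj : forall i y z, i < n -> y < ms i -> z < ms i ->
  p i y = p i z -> y = z.

Definition relabel_fun (i : 'I_n) (z : strat alpha i) : strat alpha i :=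
  inord (p i z).

Lemma relabel_funE (i : 'I_n) (z : strat alpha i) : relabel_fun z = p i z :> nat.
Proof.
have zi : z < ms i by rewrite ms_ord.
by rewrite inordK //; have := p_lt (ltn_ord i) zi; rewrite ms_ord.
Qed.

Lemma relabel_fun_inj (i : 'I_n) : injective (@relabel_fun i).
Proof.
move=> y z /(congr1 val) /=; rewrite !relabel_funE => /p_inj E.
by apply/val_inj/E; rewrite ?ms_ord.
Qed.

Definition tau : relabeling alpha := fun i => perm (@relabel_fun_inj i).

Lemma tauE (i : 'I_n) (z : strat alpha i) : tau i z = p i z :> nat.
Proof. by rewrite permE relabel_funE. Qed.

Lemma entry_relabeled q : entry (relabeled ms p n q) =
  relabel tau g (profile_at alpha q).
Proof.
rewrite entryE; last by apply: (relabeled_lt ms_ge2) => i z; apply: p_lt.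
congr (nat_of_bool (g _)); apply/ffunP => i; apply: val_inj => /=.
rewrite profile_at_dig (dig_horner ms_ge2) => [|j jn|//].
  by rewrite ffunE tauE profile_at_dig.
by rewrite p_lt // (dig_lt ms_ge2).
Qed.

Lemma digit_sumE q : digit_sum ms n q = \sum_i profile_at alpha q i.
Proof. by apply: eq_bigr => i _; rewrite profile_at_dig. Qed.

Lemma threshold_consistent :
  threshold (relabel tau g) = all (consistent ms n entry p) (iota 0 N).
Proof.
have E q : consistent ms n entry p q =
    admissible alpha (relabel tau g (profile_at alpha q)) (\sum_i profile_at alpha q i).
  rewrite /consistent entry_relabeled digit_sumE off_sigma addnK mul2n /admissible.
  by case: (relabel _ _ _).
apply/thresholdP/allP => [H q _ | H z]; first by rewrite E.
by rewrite -(rankK z) -E; apply: H; rewrite mem_iota rank_lt.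
Qed.

End Relabeling.

Lemma output_okP p st : solution ms n entry p st -> output_ok g st.
Proof.
case=> -[p_lt p_inj p_mono] [[r0 r1 r2 r3] mK mP mO]; split.
  rewrite r1; apply: stored_per_plane => i z.
  by rewrite addnA mK ?ms_ord // s_key.
exists (tau p_lt p_inj); split.
- move=> i y z yz; rewrite !s_relabel !s_key !tauE.
  by apply: p_mono; rewrite ?ms_ord.
- rewrite r2; apply: stored_per_plane => i z.
  by rewrite mP ?ms_ord // tauE.
- rewrite r3; apply: stored_array => q qN.
  by rewrite mO // (entry_relabeled p_lt p_inj).
- by rewrite r0 (threshold_consistent p_lt p_inj).
Qed.

Lemma main_prog_correct :
  exists t st, [/\ exec (table_size alpha ^ 4) main_prog (initial_state g) t st,
    t <= 6 * 1000 * table_size alpha & output_ok g st].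
Proof.
rewrite table_sizeE.
have N4 : 4 <= N.
  by apply: leq_trans (n_le ms_ge2 n2); rewrite (leq_double 2).
(* 64 = 4^3 is at most N^3, whence the exponent 4 of the word bound. *)
have W_ge : 64 * N <= N ^ 4.
  by rewrite expnSr leq_mul2r (@leq_exp2r 4 N 3) // N4 orbT.
have sz : size [seq alpha i | i <- enum 'I_n] = n by rewrite size_map size_enum_ord.
have szA : size (array_of g) = N by rewrite size_mkseq table_sizeE.
have [||| t [st [ex le [p sol]]]] :=
  main_wp ms_ge2 entry_le1 n2 W_ge (m := nth 0 (input g)).
- split=> // i ni; rewrite !addn1 /= nth_cat sz ni /ms.
  by congr _.+1; apply: set_nth_default; rewrite sz.
- by move=> x xN; rewrite addSn /= nth_cat sz ltnNge leq_addr addKn.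
- move=> a Ha; rewrite nth_default //= size_cat sz szA; lia.
exists t, st; split=> //; first by rewrite -mulnA.
exact: output_okP sol.
Qed.

End Correctness.

Theorem theorem21 :
  (forall (n : nat) (alpha : 'I_n -> nat) (g : voting_form alpha)
          (tau : relabeling alpha),
     2 <= n -> (forall i, 1 <= alpha i) ->
     planes_sorted (relabel tau g) ->
     (DAV g <-> threshold (relabel tau g)))
  /\
  (exists (prog : cmd) (C k : nat),
     forall (n : nat) (alpha : 'I_n -> nat) (g : voting_form alpha),
       2 <= n -> (forall i, 1 <= alpha i) ->
       exists (t : nat) (st : state),
         [/\ exec (table_size alpha ^ k) prog (initial_state g) t st,
             t <= C * table_size alpha
           & output_ok g st]).
Proof.
split=> [n alpha g tau _ _ | ]; first exact: characterization.
by exists main_prog, (6 * 1000), 4 => n alpha g n2 alpha1; apply: main_prog_correct.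
Qed.
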